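(* Let $\mathcal A$ be a line arrangement in $\mathbb P^2$ with $d=|\mathcal A|\ge 2$, having $n_2$ double points, $n_3$ triple points and no points of higher multiplicity. Let $\mathcal A(2,2,3)$ be the arrangement $(x^2-y^2)(x^2-z^2)(y^2-z^2)=0$. (1) If $n_3=0$, then $r(\mathcal A)=d-2$. (2) If $1\le n_3\le 3$, then $r(\mathcal A)=d-3$. (3) If $n_3=4$, then $r(\mathcal A)=d-3$, unless every line of $\mathcal A$ passing through a triple point of $\mathcal A$ contains an extra (i.e. another) triple point of $\mathcal A$. In this latter situation, $\mathcal A$ is obtained, up to a change of coordinates, from $\mathcal A(2,2,3)$ by adding $d-6$ generic lines, and then $r(\mathcal A)=d-4$. (4) If $n_3=5$, then there are two possibilities. (A) There is at least one triple point $p$ in $\mathcal A$ and a line $L$ in $\mathcal A$ passing through $p$ and containing only $p$ as a triple point. If the line arrangement $\mathcal A'=\mathcal A\setminus L$ is obtained, up to a change of coordinates, from $\mathcal A(2,2,3)$ by adding $d-7$ generic lines, then $r(\mathcal A)=d-4$. Otherwise $r(\mathcal A)=d-3$. (B) For any of the $5$ triple points, the $3$ lines meeting at this point each contain at least one extra triple point, and then $r(\mathcal A)=d-4$. The intersection lattice of $\mathcal A$ in this case is the same as the intersection lattice of the arrangement obtained by adding $d-7$ generic lines to the arrangement $$\mathcal B: y(y+x)(y-x)(y+x-2z)(y-x-2z)(3y+x-2z)(3y-x-2z)=0.$$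
   Context: $\mathbb K$ is a field of characteristic zero, $S=\mathbb K[x,y,z]$ with the standard grading. A line arrangement $\mathcal A$ in $\mathbb P^2$ is a finite set of distinct lines, given by $f=0$ with $f\in S$ a product of pairwise non-proportional linear forms. $r(\mathcal A)$ is the minimal degree $r$ for which there is a nonzero triple $(a,b,c)\in S_r^3$ with $af_x+bf_y+cf_z=0$. The multiplicity of a point is the number of lines of $\mathcal A$ through it; double (triple) points are points of multiplicity $2$ ($3$). Adding generic lines to an arrangement means adding lines successively, each new line meeting the previously constructed arrangement only at simple points (i.e. passing through no point of multiplicity $\ge 2$). *)

(* Defs.v *)
From HB Require Import structures.
From mathcomp Require Import all_boot all_order all_algebra.
From mathcomp Require Import finmap.
From mathcomp Require Import mpoly.

Set Implicit Arguments.
Unset Strict Implicit.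
Unset Printing Implicit Defensive.

Import GRing.Theory.

Local Open Scope ring_scope.

(* The projective plane over K: points and lines are the subspaces of K^3 of
   dimension 1 and 2, so the point p lies on the line L when (p <= L)%VS. *)
Notation subspace K := {vspace 'rV[K]_3}.

Section Arrangements.

Variable K : fieldType.

Implicit Types (A B C : {fset subspace K}) (L p q X Y : subspace K).
Implicit Types (f l : {mpoly K[3]}).

Definition is_point p := \dim p == 1%N.
Definition is_line L := \dim L == 2%N.

Definition is_arrangement A := forall L, L \in A -> is_line L.

Definition multiplicity A p : nat := #|` [fset L in A | (p <= L)%VS]%fset |.

Definition has_multiplicity (m : nat) A p :=
  is_point p && (multiplicity A p == m).

Definition nb_points (m : nat) A (n : nat) :=
  exists2 P : {fset subspace K},
    #|` P| = n & forall p, (p \in P) = has_multiplicity m A p.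

Definition triple_point A p := has_multiplicity 3 A p.

Definition is_equation_of_line L l :=
  l \is 1.-homog /\ forall u : 'rV[K]_3, (u \in L) = (l.@[u ord0] == 0).

(* The equation f is determined by A up to a nonzero scalar factor. *)
Definition is_equation A f :=
  exists2 l : subspace K -> {mpoly K[3]},
    forall L, L \in A -> is_equation_of_line L (l L)
    & f = \prod_(L <- A) l L.

Definition has_syzygy f (r : nat) :=
  exists a : 'I_3 -> {mpoly K[3]},
    [/\ forall i, a i \is r.-homog,
        exists i, a i != 0
      & \sum_(i < 3) a i * f^`M(i) = 0].

(* min_syzygy_degree f r states that r(A) = r when f is an equation of A. *)
Definition min_syzygy_degree f (r : nat) :=
  has_syzygy f r /\ forall s, has_syzygy f s -> (r <= s)%N.

Inductive add_generic_lines A : nat -> {fset subspace K} -> Prop :=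
| AddNoLine : add_generic_lines A 0 A
| AddGenericLine n C L :
    add_generic_lines A n C ->
    is_line L -> L \notin C ->
    (forall p, is_point p -> (p <= L)%VS -> (multiplicity C p <= 1)%N) ->
    add_generic_lines A n.+1 (L |` C)%fset.

Definition projectively_equivalent A C :=
  exists2 g : 'End('rV[K]_3),
    lker g == 0%VS & C = [fset (g @: L)%VS | L in A]%fset.

Definition coords (a b c : K) : 'cV[K]_3 := \col_i [:: a; b; c]`_i.

(* The line a x + b y + c z = 0. *)
Definition line (a b c : K) : subspace K :=
  lker (linfun (mulmxr (coords a b c)) : 'Hom('rV[K]_3, 'rV[K]_1)).

Lemma mem_line a b c (u : 'rV[K]_3) :
  (u \in line a b c) =
  (a * u ord0 (inord 0) + b * u ord0 (inord 1) + c * u ord0 (inord 2) == 0).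
Proof.
rewrite memv_ker lfunE /=.
have -> : u *m coords a b c = const_mx
    (a * u ord0 (inord 0) + b * u ord0 (inord 1) + c * u ord0 (inord 2)).
  apply/matrixP => i j; rewrite !ord1 !mxE !big_ord_recl big_ord0 !mxE /=.
  rewrite addr0 addrA ![u _ _ * _]mulrC.
  by congr (_ * u _ _ + _ * u _ _ + _ * u _ _); apply/val_inj; rewrite /= inordK.
apply/eqP/eqP => [/matrixP/(_ ord0 ord0)|->]; first by rewrite !mxE.
by apply/matrixP => i j; rewrite !mxE.
Qed.

(* (x^2 - y^2) (x^2 - z^2) (y^2 - z^2) = 0 *)
Definition A223 : {fset subspace K} :=
  [fset line 1 (-1) 0; line 1 1 0;
        line 1 0 (-1); line 1 0 1;
        line 0 1 (-1); line 0 1 1]%fset.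

(* y (y+x) (y-x) (y+x-2z) (y-x-2z) (3y+x-2z) (3y-x-2z) = 0 *)
Definition arrangement_B : {fset subspace K} :=
  [fset line 0 1 0; line 1 1 0; line (-1) 1 0;
        line 1 1 (- 2%:R); line (-1) 1 (- 2%:R);
        line 1 3%:R (- 2%:R); line (-1) 3%:R (- 2%:R)]%fset.

Definition from_A223 A (n : nat) :=
  exists2 C, add_generic_lines A223 n C & projectively_equivalent C A.

(* The empty subset of A contributes the whole space. *)
Definition intersections A : {fset subspace K} :=
  [fset (\bigcap_(L <- enum_fset B) L)%VS | B : {fset subspace K} in fpowerset A]%fset.

Definition same_intersection_lattice A C :=
  exists2 phi : subspace K -> subspace K,
    {in intersections A &, {mono phi : X Y / (X <= Y)%VS}}
    & intersections C = [fset phi X | X in intersections A]%fset.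

Definition sole_triple_point_on A p L :=
  [/\ triple_point A p, L \in A, (p <= L)%VS
    & forall q, triple_point A q -> (q <= L)%VS -> q = p].

Definition lines_have_extra_triple_point A :=
  forall p L, triple_point A p -> L \in A -> (p <= L)%VS ->
    exists q, [/\ triple_point A q, q != p & (q <= L)%VS].

End Arrangements.

Arguments A223 K : clear implicits.
Arguments arrangement_B K : clear implicits.

(* Main.v *)
Require Import Defs.
From HB Require Import structures.
From mathcomp Require Import all_boot all_order all_algebra.
From mathcomp Require Import finmap.
From mathcomp Require Import mpoly.
From mathcomp Require Import ring zify.
From Stdlib Require Import Classical_Prop.

Set Implicit Arguments.
Unset Strict Implicit.
Unset Printing Implicit Defensive.

Import GRing.Theory.

Local Open Scope ring_scope.

(** The number r(A) is read off from geometry instead of from an equation.  A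
    triple of forms of degree r is a polynomial vector field t on K^3; call it
    tangent to A when t maps every line of A, seen as a plane of K^3, into
    itself.  A syzygy of the partial derivatives of f is such a field, and it
    is not radial, that is, not a multiple of the Euler field; conversely, in
    characteristic zero, subtracting a suitable multiple of the Euler field
    turns a nonradial tangent field into a syzygy.  So r(A) is the least degree
    of a nonradial tangent field (log_field, min_syzygy_degreeP), a notion in
    which coordinates and equations no longer occur.

    Lower bounds come from deleting a line L that carries h points of
    intersection with the other lines (log_field_deletion).  On L, the
    obstruction to being radial is a form of degree r + 1 which vanishes at
    the h points.  If r + 1 < h it is zero, so that the field equals, up to a
    multiple of the Euler field, the equation of L times a field tangent to the
    remaining lines.  Hence r(A) >= min(h - 1, r(A - L) + 1).  When no point
    has multiplicity above 3, a line with k triple points has h = d - 1 - k.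

    Upper bounds come from three constructions: a constant field pointing to a
    point of multiplicity m, times the d - m lines that avoid it; the
    multiplication of a field by the equation of a new line, which costs one
    degree per line; and, for two points u and v and a line M that avoids them,
    when k points of M are joined to both u and v, a field of degree k
    tangent to M, to the 2k joining lines and to the line uv
    (log_field_pencil).  The last one gives degree 2 for the complete
    quadrilateral and degree 3 for the seven lines spanned by five triple points.

    What remains is combinatorics.  As long as there are at most three triple
    points, some line through a triple point contains no other one, and
    removing it brings the number of triple points down by one.  If all lines
    through the triple points contain another one, then four triple points are
    the vertices of a complete quadrilateral, which is projectively unique
    (exists_frame), and five triple points are, by a parity argument, three
    points on a line of A together with two points joined to each of them.  All
    other lines pass through no triple point, which is to say that they are
    generic.  Finally an intersection lattice of lines is determined by the
    triples of concurrent lines (lattice_of_concurrences), and in this last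
    situation these are exactly the five pencils of three among the seven
    lines. *)

(** * Homogeneous polynomial functions on K^3 *)

Section Forms.

Variable K : fieldType.
Hypothesis charK : [pchar K] =i pred0.

Local Notation V := 'rV[K]_3.
Implicit Types (F G : V -> K) (u v w e : V) (c : 'cV[K]_3) (U : {vspace V}).

Definition dot u c : K := (u *m c) ord0 ord0.

Lemma dotE u c : dot u c = \sum_i u ord0 i * c i ord0.
Proof. by rewrite /dot mxE. Qed.

Lemma dotD u v c : dot (u + v) c = dot u c + dot v c.
Proof. by rewrite /dot mulmxDl mxE. Qed.

Lemma dotZ k u c : dot (k *: u) c = k * dot u c.
Proof. by rewrite /dot -scalemxAl mxE. Qed.

Lemma dotN u c : dot (- u) c = - dot u c.
Proof. by rewrite /dot mulNmx mxE. Qed.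

Lemma dotB u v c : dot (u - v) c = dot u c - dot v c.
Proof. by rewrite dotD dotN. Qed.

Lemma dotDr u c d : dot u (c + d) = dot u c + dot u d.
Proof. by rewrite /dot mulmxDr mxE. Qed.

Lemma dotZr k u c : dot u (k *: c) = k * dot u c.
Proof. by rewrite /dot -scalemxAr mxE. Qed.

(** Forms are handled as functions, which makes linear substitutions and
    restrictions to a line immediate; the polynomial behind the function is
    unique by [mpoly_eval_inj]. *)
Definition hform r F :=
  exists2 p : {mpoly K[3]}, p \is r.-homog & forall u, F u = p.@[u ord0].

Lemma eq_hform r F G : F =1 G -> hform r F -> hform r G.
Proof. by move=> eqFG [p hp pE]; exists p => // u; rewrite -eqFG. Qed.

Lemma hform_const k : hform 0 (fun=> k).
Proof.
exists (k *: 1) => [|u]; last by rewrite mevalZ meval1 mulr1.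
by rewrite dhomogZ // dhomog1.
Qed.

Lemma hform0 r : hform r (fun=> 0).
Proof. by exists 0 => [|u]; rewrite ?dhomog0 // meval0. Qed.

Lemma hform_coord i : hform 1 (fun u => u ord0 i).
Proof. by exists 'X_i => [|u]; rewrite ?mevalXU // dhomogX /= mdeg1. Qed.

Lemma hformD r F G : hform r F -> hform r G -> hform r (fun u => F u + G u).
Proof.
by move=> [p hp pE] [q hq qE]; exists (p + q) => [|u]; rewrite ?rpredD // mevalD pE qE.
Qed.

Lemma hformM r s F G : hform r F -> hform s G -> hform (r + s) (fun u => F u * G u).
Proof.
by move=> [p hp pE] [q hq qE]; exists (p * q) => [|u]; rewrite ?dhomogM // mevalM pE qE.
Qed.

Lemma hformZ r k F : hform r F -> hform r (fun u => k * F u).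
Proof. by move=> hF; rewrite -[r]add0n; apply: hformM => //; apply: hform_const. Qed.

Lemma hformN r F : hform r F -> hform r (fun u => - F u).
Proof. by move/(hformZ (-1)); apply: eq_hform => u; rewrite mulN1r. Qed.

Lemma hformB r F G : hform r F -> hform r G -> hform r (fun u => F u - G u).
Proof. by move=> hF /hformN hG; apply: hformD. Qed.

Lemma hform_sum (I : eqType) r (s : seq I) (F : I -> V -> K) :
  (forall i, i \in s -> hform r (F i)) -> hform r (fun u => \sum_(i <- s) F i u).
Proof.
elim: s => [_|i s IHs hF].
  by apply: eq_hform (hform0 r) => u; rewrite big_nil.
apply: (@eq_hform _ (fun u => F i u + \sum_(j <- s) F j u)) => [u|].
  by rewrite big_cons.
apply: hformD; first by apply: hF; rewrite mem_head.
by apply: IHs => j js; apply: hF; rewrite inE js orbT.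
Qed.

Lemma hform_dot c : hform 1 (dot^~ c).
Proof.
apply: (@eq_hform _ (fun u => \sum_(i : 'I_3) c i ord0 * u ord0 i)) => [u|].
  by rewrite dotE; apply: eq_bigr => i _; rewrite mulrC.
by apply: hform_sum => i _; apply/hformZ/hform_coord.
Qed.

Lemma hform_prod (I : eqType) (s : seq I) (F : I -> V -> K) :
  (forall i, i \in s -> hform 1 (F i)) ->
  hform (size s) (fun u => \prod_(i <- s) F i u).
Proof.
elim: s => [_|i s IHs hF].
  by apply: eq_hform (hform_const 1) => u; rewrite big_nil.
apply: (@eq_hform _ (fun u => F i u * \prod_(j <- s) F j u)) => [u|].
  by rewrite big_cons.
apply: (@hformM 1); first by apply: hF; rewrite mem_head.
by apply: IHs => j js; apply: hF; rewrite inE js orbT.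
Qed.

(** A form of positive degree is a sum of coordinates times forms of degree
    one less, so a property may be checked along this construction. *)
Lemma hform_ind (P : nat -> (V -> K) -> Prop) :
    (forall r F G, F =1 G -> P r F -> P r G) ->
    (forall k, P 0 (fun=> k)) ->
    (forall r i F, hform r F -> P r F -> P r.+1 (fun u => u ord0 i * F u)) ->
    (forall r F G, hform r F -> hform r G -> P r F -> P r G ->
       P r (fun u => F u + G u)) ->
  forall r F, hform r F -> P r F.
Proof.
move=> Pext Pc PX PD.
have P0 r : P r (fun=> 0) /\ hform r (fun=> 0).
  split; last exact: hform0.
  elim: r => [|r IHr]; first exact: Pc.
  by apply: Pext (PX _ ord0 _ (hform0 r) IHr) => u; rewrite mulr0.
have PM r (m : 'X_{1..3}) k : mdeg m = r ->
    P r (fun u => (k *: 'X_[m] : {mpoly K[3]}).@[u ord0]) /\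
    hform r (fun u => (k *: 'X_[m] : {mpoly K[3]}).@[u ord0]).
  elim: r m => [|r IHr] m hm.
    split; last by exists (k *: 'X_[m]) => //; rewrite dhomogZ // dhomogX /= hm.
    apply: Pext (Pc k) => u; move/eqP: hm; rewrite mdeg_eq0 => /eqP ->.
    by rewrite mpolyX0 mevalZ meval1 mulr1.
  split; last by exists (k *: 'X_[m]) => //; rewrite dhomogZ // dhomogX /= hm.
  have [i mi] : exists i, m i != 0%N.
    apply/existsP; rewrite -negb_forall; apply/negP => /forallP m0.
    have : mdeg m = 0%N by rewrite mdegE big1 // => i _; apply/eqP.
    by rewrite hm.
  have mE : m = (m - U_(i) + U_(i))%MM.
    by rewrite submK // lep1mP.
  have hm' : mdeg (m - U_(i)) = r.
    by move: hm; rewrite {1}mE mdegD mdeg1 addn1 => -[].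
  have [IH1 IH2] := IHr _ hm'.
  apply: Pext (PX _ i _ IH2 IH1) => u.
  by rewrite [in RHS]mE mpolyXD !mevalZ mevalM mevalXU; ring.
move=> r F [p hp pE].
apply: (Pext r (fun u => \sum_(m <- msupp p) (p@_m *: 'X_[m]).@[u ord0])).
  by move=> u; rewrite pE mevalE; apply: eq_bigr => m _; rewrite mevalZ mevalX.
suff [] : P r (fun u => \sum_(m <- msupp p) (p@_m *: 'X_[m]).@[u ord0]) /\
          hform r (fun u => \sum_(m <- msupp p) (p@_m *: 'X_[m]).@[u ord0]) by [].
elim: (msupp p) (dhomogP _ _ _ hp) => [_|m s IHs hs].
  split; first by apply: Pext (P0 r).1 => u; rewrite big_nil.
  by apply: eq_hform (P0 r).2 => u; rewrite big_nil.
have [|P1 F1] := IHs; first by move=> m' ms; apply: hs; rewrite inE ms orbT.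
have [P2 F2] := PM r m p@_m (hs m (mem_head _ _)).
split.
  by apply: Pext (PD _ _ _ F2 F1 P2 P1) => u; rewrite big_cons.
by apply: eq_hform (hformD F2 F1) => u; rewrite big_cons.
Qed.

Lemma hform_scale r F : hform r F -> forall k u, F (k *: u) = k ^+ r * F u.
Proof.
move=> hF; elim/hform_ind: r F / hF => [r F G FG IH k u|a k u|r i F _ IH k u|r F G _ _ IF IG k u].
- by rewrite -!FG.
- by rewrite mul1r.
- by rewrite IH mxE exprS; ring.
- by rewrite IF IG mulrDr.
Qed.

Lemma hform_on_line r F : hform r F ->
  forall u w, exists q : {poly K}, forall t, F (u + t *: w) = q.[t].
Proof.
move=> hF; elim/hform_ind: r F / hF => [r F G FG IH u w|k _ _|r i F _ IH u w|r F G _ _ IF IG u w].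
- by have [q qE] := IH u w; exists q => t; rewrite -FG qE.
- by exists k%:P => t; rewrite hornerC.
- have [q qE] := IH u w; exists (((u ord0 i)%:P + w ord0 i *: 'X) * q) => t.
  by rewrite hornerM hornerD hornerC hornerZ hornerX qE !mxE [t * _]mulrC.
- have [q qE] := IF u w; have [p pE] := IG u w; exists (q + p) => t.
  by rewrite hornerD qE pE.
Qed.

(** A form of degree r - 1, which for r = 0 can only be zero. *)
Definition hform_below r F := if r is s.+1 then hform s F else forall u, F u = 0.

Lemma hform_below_coord r F i : hform_below r F -> hform r (fun u => u ord0 i * F u).
Proof.
case: r => [F0|r hF]; last exact: (@hformM 1 r _ _ (hform_coord i)).
by apply: eq_hform (hform0 0) => u; rewrite F0 mulr0.
Qed.

(** Moving u along e by the amount c u changes F by a multiple of c. This is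
    division by a linear form without choosing coordinates: when c takes the
    value 1 at e, the argument of the remainder is the projection of u to
    the kernel of c along e. *)
Lemma hform_division r F c e : hform r F ->
  exists2 Q, hform_below r Q &
    forall u, F u = F (u - dot u c *: e) + dot u c * Q u.
Proof.
move=> hF; elim/hform_ind: r F / hF
  => [r F G FG [Q hQ QE]|k|r i F hF [Q hQ QE]|r F G _ _ [Q hQ QE] [Q' hQ' QE']].
- by exists Q => // u; rewrite -!FG -QE.
- by exists (fun=> 0) => // u; rewrite mulr0 addr0.
- exists (fun u => u ord0 i * Q u + e ord0 i * F (u - dot u c *: e)).
    move=> /=; apply: hformD; first exact: hform_below_coord.
    apply: hformZ; have FE u : F u - dot u c * Q u = F (u - dot u c *: e).
      by rewrite {1}QE addrK.
    apply: eq_hform FE _; apply: hformB => //.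
    case: r hQ {hF} => [Q0|r hQ]; last exact: (@hformM 1 r _ _ (hform_dot c)).
    by apply: eq_hform (hform0 0) => u; rewrite Q0 mulr0.
  by move=> u; rewrite {1}QE !mxE; ring.
- exists (fun u => Q u + Q' u).
    case: r hQ hQ' => [|r]; last exact: hformD.
    by move=> q0 q'0 u; rewrite q0 q'0 addr0.
  by move=> u; rewrite {1}QE {1}QE'; ring.
Qed.

Lemma natr_eq0_char0 n : (n%:R == 0 :> K) = (n == 0%N).
Proof. by have /pcharf0P -> := charK. Qed.

Lemma natr_inj_char0 : injective (fun n : nat => n%:R : K).
Proof.
suff lt m n : (m < n)%N -> m%:R <> n%:R :> K.
  by move=> m n /= mn; case: (ltngtP m n) => // /lt; rewrite mn.
move=> mn /esym/eqP; rewrite -subr_eq0 -natrB; last exact: ltnW.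
by rewrite natr_eq0_char0 subn_eq0 leqNgt mn.
Qed.

Lemma poly_neq0_horner (q : {poly K}) : q != 0 -> exists t, q.[t] != 0.
Proof.
move=> qn0; pose s := [seq n%:R : K | n <- iota 0 (size q)].
suff /hasP[t _ qt] : has (predC (root q)) s by exists t.
rewrite has_predC; apply/negP => qs; have := max_poly_roots qn0 qs.
rewrite size_map size_iota ltnn => /(_ _)/notF; apply.
by rewrite map_inj_uniq ?iota_uniq //; apply: natr_inj_char0.
Qed.

(** On the line through u and v both forms become polynomials in one
    variable, and their product is nonzero; an infinite field has enough
    points to see this. *)
Lemma hform_mul_neq0 U r s F G u v : hform r F -> hform s G ->
    u \in U -> v \in U -> F u != 0 -> G v != 0 ->
  exists2 w, w \in U & F w * G w != 0.
Proof.
move=> hF hG uU vU Fu Gv.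
have [p pE] := hform_on_line hF u (v - u); have [q qE] := hform_on_line hG u (v - u).
have [|t] := @poly_neq0_horner (p * q).
  rewrite mulf_neq0 //.
    by apply: contraNneq Fu => p0; have := pE 0; rewrite scale0r addr0 p0 horner0 => ->.
  by apply: contraNneq Gv => q0; have := qE 1; rewrite scale1r subrKC q0 horner0 => ->.
rewrite hornerM -pE -qE => FGt; exists (u + t *: (v - u)) => //.
by rewrite memvD // memvZ // memvB.
Qed.

Lemma hform_domain U r s F G v : hform r F -> hform s G ->
    {in U, forall u, F u * G u = 0} -> v \in U -> G v != 0 ->
  {in U, forall u, F u = 0}.
Proof.
move=> hF hG FG vU Gv u uU; apply/eqP/negPn/negP => Fu.
by have [w wU] := hform_mul_neq0 hF hG uU vU Fu Gv; rewrite FG ?eqxx.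
Qed.

Lemma hform_prod_neq0 U (I : eqType) (s : seq I) (F : I -> V -> K) :
    (forall i, i \in s -> hform 1 (F i)) ->
    (forall i, i \in s -> exists2 u, u \in U & F i u != 0) ->
  exists2 u, u \in U & \prod_(i <- s) F i u != 0.
Proof.
elim: s => [_ _|i s IHs hF F0].
  by exists 0; rewrite ?mem0v // big_nil oner_neq0.
have [||v vU Fs] := IHs.
- by move=> j js; apply: hF; rewrite inE js orbT.
- by move=> j js; apply: F0; rewrite inE js orbT.
have [u uU Fu] := F0 _ (mem_head i s).
have hs : hform (size s) (fun u => \prod_(i <- s) F i u).
  by apply: hform_prod => j js; apply: hF; rewrite inE js orbT.
have [w wU FGw] := hform_mul_neq0 (hF _ (mem_head i s)) hs uU vU Fu Fs.
by exists w; rewrite // big_cons.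
Qed.

(** Scaling the i-th coordinate by t and comparing coefficients of powers of
    t separates the monomials by their i-th exponent. *)
Lemma sum_coord_eq0 (s : seq 'X_{1..3}) (P : pred 'X_{1..3}) (a : 'X_{1..3} -> K) i k :
    (forall v : 'I_3 -> K, \sum_(m <- s | P m) a m * \prod_j v j ^+ m j = 0) ->
  forall v : 'I_3 -> K, \sum_(m <- s | P m && (m i == k)) a m * \prod_j v j ^+ m j = 0.
Proof.
move=> s0 v.
pose q : {poly K} := \sum_(m <- s | P m) (a m * \prod_j v j ^+ m j) *: 'X^(m i).
have q0 : q = 0.
  apply/eqP/negPn/negP => /poly_neq0_horner[t] /eqP; apply.
  rewrite horner_sum -[RHS](s0 (fun j => (if j == i then t else 1) * v j)).
  apply: eq_bigr => m _; rewrite hornerZ hornerXn -mulrA; congr (_ * _).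
  under [in RHS]eq_bigr do rewrite exprMn.
  rewrite big_split /= mulrC; congr (_ * _).
  rewrite (bigD1 i) //= eqxx big1 ?mulr1 // => j /negPf ->.
  by rewrite expr1n.
have := congr1 (fun q : {poly K} => q`_k) q0.
rewrite coef0 coef_sum => qk; rewrite -[RHS]qk big_mkcondr; apply: eq_bigr => m _.
by rewrite coefZ coefXn eq_sym; case: eqP; rewrite ?mulr1 ?mulr0.
Qed.

(** Separating the exponents of the three variables in turn isolates a
    single monomial. *)
Lemma mpoly_eval_eq0 (p : {mpoly K[3]}) : (forall v : V, p.@[v ord0] = 0) -> p = 0.
Proof.
move=> p0; apply/mpolyP => m; rewrite mcoeff0.
have s0 (v : 'I_3 -> K) : \sum_(m' <- msupp p | true) p@_m' * \prod_j v j ^+ m' j = 0.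
  rewrite -mevalE -[RHS](p0 (\row_j v j)).
  by apply: meval_eq => j; rewrite mxE.
have s1 := sum_coord_eq0 ord0 (m ord0) s0.
have s2 := sum_coord_eq0 (inord 1) (m (inord 1)) s1.
have := sum_coord_eq0 (inord 2) (m (inord 2)) s2 (fun=> 1).
have mE (m' : 'X_{1..3}) : true && (m' ord0 == m ord0) && (m' (inord 1) == m (inord 1))
  && (m' (inord 2) == m (inord 2)) = (m' == m).
  apply/idP/eqP => [/andP[/andP[/eqP m0 /eqP m1] /eqP m2]|->]; last by rewrite !eqxx.
  apply/mnmP => -[[|[|[|]]]] // lt3.
  - by rewrite (_ : Ordinal lt3 = ord0) //; apply/val_inj.
  - by rewrite (_ : Ordinal lt3 = inord 1) //; apply/val_inj; rewrite /= inordK.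
  - by rewrite (_ : Ordinal lt3 = inord 2) //; apply/val_inj; rewrite /= inordK.
rewrite (eq_bigl _ _ mE).
have [mp|/memN_msupp_eq0 -> //] := boolP (m \in msupp p).
rewrite -big_filter filter_pred1_uniq ?msupp_uniq // big_seq1.
by rewrite big1 ?mulr1 // => j _; rewrite expr1n.
Qed.

Lemma mpoly_eval_inj (p q : {mpoly K[3]}) :
  (forall v : V, p.@[v ord0] = q.@[v ord0]) -> p = q.
Proof.
move=> pq; apply/eqP; rewrite -subr_eq0; apply/eqP/mpoly_eval_eq0 => v.
by rewrite mevalB pq subrr.
Qed.

End Forms.


(** * Points and lines *)

Section Planes.

Variable K : fieldType.

Local Notation V := 'rV[K]_3.
Implicit Types (u v w e : V) (c : 'cV[K]_3) (L p q : subspace K).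

Lemma dim_space : \dim {:V} = 3%N.
Proof. by rewrite dimvf /dim /= mul1n. Qed.

Lemma point_eq p q : is_point p -> is_point q -> (p <= q)%VS -> p = q.
Proof.
move=> /eqP dp /eqP dq pq; apply/eqP; rewrite eqEdim pq /= dp dq.
by [].
Qed.

Lemma is_point_line v : v != 0 -> is_point <[v]>%VS.
Proof. by rewrite /is_point dim_vline => ->. Qed.

Lemma is_pointP p : is_point p -> exists2 v, v != 0 & p = <[v]>%VS.
Proof.
move=> pp; have pn0 : vpick p != 0 by rewrite vpick0 -dimv_eq0 (eqP pp).
exists (vpick p) => //; symmetry; apply: point_eq => //.
  exact: is_point_line.
by rewrite -memvE memv_pick.
Qed.

Lemma point_cap p q : is_point p -> is_point q -> p != q -> (p :&: q = 0)%VS.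
Proof.
move=> pp qp; apply: contraNeq => pq0; apply/eqP.
have pq1 : is_point (p :&: q)%VS.
  rewrite /is_point eqn_leq lt0n dimv_eq0 pq0 andbT.
  by rewrite -[leqRHS](eqP pp) dimvS ?capvSl.
by rewrite -(point_eq pq1 pp (capvSl _ _)); apply: point_eq; rewrite ?capvSr.
Qed.

Lemma line_through p q L : is_point p -> is_point q -> p != q -> is_line L ->
  (p <= L)%VS -> (q <= L)%VS -> L = (p + q)%VS.
Proof.
move=> pp qp pq /eqP dL pL qL; apply/esym/eqP; rewrite eqEdim subv_add pL qL /= dL.
by rewrite dimv_disjoint_sum ?(eqP pp) ?(eqP qp) // point_cap.
Qed.

Lemma line_unique p q L L' : is_point p -> is_point q -> p != q ->
  is_line L -> is_line L' -> (p <= L)%VS -> (q <= L)%VS ->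
  (p <= L')%VS -> (q <= L')%VS -> L = L'.
Proof.
by move=> pp qp pq lL lL' pL qL pL' qL'; rewrite (line_through pp qp pq lL) //;
   apply/esym/line_through.
Qed.

Lemma line_notsub L L' : is_line L -> is_line L' -> L != L' -> ~~ (L <= L')%VS.
Proof.
by move=> /eqP dL /eqP dL'; apply: contraNN => LL'; rewrite eqEdim LL' dL dL'.
Qed.

Lemma line_cap L L' : is_line L -> is_line L' -> L != L' -> is_point (L :&: L')%VS.
Proof.
move=> lL lL' LL'; have nsub : ~~ (L' <= L)%VS by rewrite line_notsub // eq_sym.
have d3 : (\dim (L + L')%VS <= 3)%N by rewrite -[leqRHS]dim_space dimvS ?subvf.
have := dimv_sum_cap L L'; rewrite (eqP lL) (eqP lL') => dE.
have dS : \dim (L + L') = 3%N.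
  apply/eqP; rewrite eqn_leq d3 /= ltnNge.
  apply: contra nsub => d2; apply/capv_idPr/eqP.
  rewrite eqEdim capvSr (eqP lL') /= -(leq_add2l (\dim (L + L'))) dE.
  by rewrite leq_add2r.
by move/eqP: dE; rewrite dS -[X in _ == X]/(3 + 1)%N eqn_add2l.
Qed.

Lemma point_on_two_lines p L L' : is_point p -> is_line L -> is_line L' -> L != L' ->
  (p <= L)%VS -> (p <= L')%VS -> p = (L :&: L')%VS.
Proof.
move=> pp lL lL' LL' pL pL'; apply: point_eq => //; first exact: line_cap.
by rewrite subv_cap pL pL'.
Qed.

Lemma notin_line L : is_line L -> exists e, e \notin L.
Proof.
move=> lL; have : ~~ ({:V} <= L)%VS.
  by apply/negP => /dimvS; rewrite dim_space (eqP lL).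
by case/subvPn => e _ eL; exists e.
Qed.

(** The equation of L is one coordinate of the projection onto a complement
    of L, which is spanned by a single vector. *)
Lemma line_functional L : is_line L ->
  exists c, forall u, (u \in L) = (dot u c == 0).
Proof.
move=> lL; have dC : \dim L^C = 1%N by rewrite dimv_compl dim_space (eqP lL).
have [e en0 LC] : exists2 e, e != 0 & (L^C)%VS = <[e]>%VS by apply: is_pointP; apply/eqP.
have [i ei] : exists i, e ord0 i != 0.
  apply/existsP; rewrite -negb_forall; apply: contra en0 => /forallP e0.
  by apply/eqP/rowP => i; rewrite mxE; apply/eqP.
pose phi u := (u - projv L u) ord0 i.
exists (\col_j phi (delta_mx ord0 j)) => u.
have phiE : phi u = dot u (\col_j phi (delta_mx ord0 j)).
  rewrite dotE {1}(row_sum_delta u) /phi linear_sum -sumrB summxE.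
  by apply: eq_bigr => j _; rewrite linearZ -scalerBr !mxE.
rewrite -phiE /phi; apply/idP/eqP => [uL|].
  by rewrite projv_id // subrr mxE.
have := memv_projC L u; rewrite LC => /vlineP[k uk].
rewrite uk mxE => /eqP; rewrite mulf_eq0 (negPf ei) orbF => /eqP k0.
by move/eqP: uk; rewrite k0 scale0r subr_eq0 => /eqP ->; apply: memv_proj.
Qed.

Lemma line_basis L v : is_line L -> v \in L -> v != 0 ->
  exists w, [/\ w \in L, w \notin <[v]>%VS
    & forall u, u \in L -> exists a b, u = a *: v + b *: w].
Proof.
move=> lL vL vn0; have : ~~ (L <= <[v]>)%VS.
  by apply/negP => /dimvS; rewrite (eqP lL) dim_vline vn0.
case/subvPn => w wL wv; exists w; split=> // u.
have wn0 : w != 0 by apply: contraNneq wv => ->; apply: mem0v.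
rewrite (@line_through <[v]> <[w]> L) ?is_point_line -?memvE //.
  by move=> /memv_addP[_ /vlineP[a ->] [_ /vlineP[b ->] ->]]; exists a, b.
by apply: contraNneq wv => ->; apply: memv_line.
Qed.

End Planes.


(** * Polynomial vector fields tangent to an arrangement *)

Section Fields.

Variable K : fieldType.
Hypothesis charK : [pchar K] =i pred0.

Local Notation V := 'rV[K]_3.
Implicit Types (u v w e : V) (c : 'cV[K]_3) (L M p q : subspace K).
Implicit Types (A : {fset subspace K}) (t : V -> V).

Lemma hform_degree0 (F : V -> K) : hform 0 F -> forall u, F u = F 0.
Proof. by move=> /hform_scale hF u; have := hF 0 u; rewrite scale0r mul1r. Qed.

(** Coordinates on the plane L adapted to v: the linear form c is the
    coordinate along w. *)
Lemma line_coord L v : is_line L -> v \in L -> v != 0 ->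
  exists w c, [/\ w \in L, dot v c = 0, dot w c = 1
    & forall u, u \in L -> exists a, u = a *: v + dot u c *: w].
Proof.
move=> lL vL vn0; have [w [wL wv wP]] := line_basis lL vL vn0.
have [e eL] := notin_line lL.
have lN : is_line (<[v]> + <[e]>)%VS.
  rewrite /is_line dimv_disjoint_sum ?dim_vline ?vn0.
    by rewrite (_ : e != 0) //; apply: contraNneq eL => ->; apply: mem0v.
  apply: point_cap; rewrite ?is_point_line //.
    by apply: contraNneq eL => ->; apply: mem0v.
  by apply: contraNneq eL => ve; rewrite memvE -ve -memvE.
have [c cP] := line_functional lN.
have wc : dot w c != 0.
  rewrite -cP; apply: contraNN eL => wN.
  have wn0 : w != 0 by apply: contraNneq wv => ->; apply: mem0v.
  suff -> : L = (<[v]> + <[e]>)%VS by rewrite memvE addvSr.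
  apply: (@line_unique _ <[v]>%VS <[w]>%VS); rewrite ?is_point_line -?memvE //.
    by apply: contraNneq wv => ->; apply: memv_line.
  by rewrite memvE addvSl.
exists w, ((dot w c)^-1 *: c).
have dcE u : dot u ((dot w c)^-1 *: c) = (dot w c)^-1 * dot u c.
  by rewrite /dot -scalemxAr mxE.
have vc : dot v c = 0.
  by apply/eqP; rewrite -cP memvE addvSl.
split=> // [||u uL]; rewrite ?dcE ?vc ?mulr0 ?mulVf //.
have [a [b uE]] := wP u uL; exists a.
by rewrite [LHS]uE uE dotD !dotZ vc mulr0 add0r [_^-1 * _]mulrC mulfK.
Qed.

(** The binary form that F induces on L is divisible by the linear forms of
    its zeros; each zero lowers the degree by one, and a form of degree 0
    with a zero vanishes. *)
Lemma hform_vanish_line r (F : V -> K) L (s : seq (subspace K)) :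
    hform r F -> is_line L -> uniq s -> (r < size s)%N ->
    (forall p, p \in s -> is_point p /\ (p <= L)%VS) ->
    (forall p, p \in s -> {in p, forall u, F u = 0}) ->
  {in L, forall u, F u = 0}.
Proof.
elim: r F s => [|r IHr] F [|p s] //= hF lL.
  move=> _ _ _ Fs u uL; rewrite (hform_degree0 hF).
  by apply: (Fs p); rewrite ?mem_head ?mem0v.
move=> /andP[ps us] rs sL Fs.
have [pp pL] := sL p (mem_head _ _).
have [v vn0 pE] := is_pointP pp.
have vL : v \in L by rewrite memvE -pE.
have [w [c [wL vc wc wP]]] := line_coord lL vL vn0.
have [Q hQ QE] := hform_division c w hF.
have FQ u : u \in L -> F u = dot u c * Q u.
  move=> uL; rewrite QE; have [a uE] := wP u uL.
  rewrite (_ : F _ = 0) ?add0r //; apply: (Fs p); rewrite ?mem_head //.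
  by rewrite pE [in X in X - _]uE addrK memvZ ?memv_line.
have Q0 : {in L, forall u, Q u = 0}.
  apply: (IHr Q s hQ lL us rs) => q qs; first by apply: sL; rewrite inE qs orbT.
  have [|qp qL] := sL q _; first by rewrite inE qs orbT.
  have {qp} [x xn0 qE] := is_pointP qp.
  have xL : x \in L by rewrite memvE -qE.
  have xc : dot x c != 0.
    apply/eqP => xc; have [a xE] := wP x xL.
    case/negP: ps; rewrite (_ : p = q) //; apply/esym/point_eq => //.
      by rewrite qE is_point_line.
    by rewrite qE pE -memvE xE xc scale0r addr0 memvZ ?memv_line.
  have Qx : Q x = 0.
    apply/eqP; rewrite -(mulrI_eq0 _ (mulfI xc)) -FQ //.
    by rewrite (Fs q) ?inE ?qs ?orbT // qE memv_line.
  by move=> u; rewrite qE => /vlineP[k ->]; rewrite (hform_scale hQ) Qx mulr0.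
by move=> u uL; rewrite FQ // Q0 // mulr0.
Qed.

Definition vform r t := forall i, hform r (fun u => t u ord0 i).

Definition minor u v (i j : 'I_3) := u ord0 i * v ord0 j - u ord0 j * v ord0 i.

(** The degrees of the logarithmic vector fields along A that are not
    multiples of the Euler field; the minors of t u against u detect whether
    t is radial at u. *)
Definition log_field A r := exists t,
  [/\ vform r t,
      forall L, L \in A -> forall u, u \in L -> t u \in L
    & exists i j u, minor (t u) u i j != 0].

Lemma vform_dot r t c : vform r t -> hform r (fun u => dot (t u) c).
Proof.
move=> ht; apply: (@eq_hform _ _ (fun u => \sum_(i : 'I_3) c i ord0 * t u ord0 i)) => [u|].
  by rewrite dotE; apply: eq_bigr => i _; rewrite mulrC.
by apply: hform_sum => i _; apply: hformZ (ht i).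
Qed.

Lemma hform_minor r t i j : vform r t -> hform r.+1 (fun u => minor (t u) u i j).
Proof.
by move=> ht; rewrite -addn1; apply: hformB; apply: hformM => //; apply: hform_coord.
Qed.

Lemma minor_eq0 u v : v != 0 -> (forall i j, minor u v i j = 0) -> exists k, u = k *: v.
Proof.
move=> vn0 m0; have [j vj] : exists j, v ord0 j != 0.
  apply/existsP; rewrite -negb_forall; apply: contra vn0 => /forallP v0.
  by apply/eqP/rowP => i; rewrite mxE; apply/eqP.
exists (u ord0 j / v ord0 j); apply/rowP => i; rewrite mxE.
have /eqP := m0 i j; rewrite subr_eq0 => /eqP uv.
by rewrite mulrAC -uv mulfK.
Qed.

Lemma minor_neq0 u v : v != 0 -> u \notin <[v]>%VS -> exists i j, minor u v i j != 0.
Proof.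
move=> vn0 uv; have [/existsP[i /existsP[j m]]|] := boolP [exists i, exists j, minor u v i j != 0].
  by exists i, j.
rewrite negb_exists => /forallP m0; case/negP: uv; apply/vlineP.
apply: minor_eq0 => // i j; have := m0 i; rewrite negb_exists => /forallP/(_ j).
by rewrite negbK => /eqP.
Qed.

Lemma minorZ a u i j : minor (a *: u) u i j = 0.
Proof. by rewrite /minor !mxE; ring. Qed.

(** On L the minors of t u against u have degree r + 1 and vanish at the
    points of s, because at a point of another line the field must be
    radial. Having more than r + 1 zeros they vanish on L, so on L the field
    is P times the Euler field. Then t - P . Euler vanishes on L, hence is
    divisible by the equation of L, and the quotient is the field that is
    sought. *)
Lemma log_field_deletion A L r (s : seq (subspace K)) :
    is_arrangement A -> L \in A -> uniq s -> (r.+1 < size s)%N ->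
    (forall p, p \in s -> [/\ is_point p, (p <= L)%VS
       & exists L', [/\ L' \in A, L' != L & (p <= L')%VS]]) ->
  log_field A r -> exists2 r', r = r'.+1 & log_field (A `\ L)%fset r'.
Proof.
move=> arrA LA us rs sP [t [ht tA [i0 [j0 [u0 m0]]]]].
have lL := arrA L LA.
(* The field is radial along L. *)
have mL i j : {in L, forall u, minor (t u) u i j = 0}.
  apply: (hform_vanish_line (hform_minor i j ht) lL us rs) => p ps.
    by have [] := sP p ps.
  have [pp pL [L' [L'A L'L pL']]] := sP p ps.
  move=> u up; have [->|un0] := eqVneq u 0; first by rewrite /minor !mxE; ring.
  have pE : p = <[u]>%VS.
    by apply/esym/point_eq; rewrite ?is_point_line // -memvE.
  have : t u \in p.
    rewrite (point_on_two_lines pp lL (arrA _ L'A) _ pL pL') 1?eq_sym //.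
    by rewrite memv_cap !tA // memvE -pE.
  by rewrite pE => /vlineP[k ->]; rewrite minorZ.
have [v vn0 vL] : exists2 v, v != 0 & v \in L.
  exists (vpick L); last exact: memv_pick.
  by rewrite vpick0 -dimv_eq0 (eqP lL).
have [w [c1 [wL vc1 wc1 wP]]] := line_coord lL vL vn0.
have hg := vform_dot c1 ht.
(* P is the factor by which t stretches u on L; it is found as the quotient
   of the c1-coordinates of t u and u. *)
have [P hP PE] := hform_division c1 w hg.
have gE u : u \in L -> dot (t u) c1 = dot u c1 * P u.
  move=> uL; rewrite PE; have [a uE] := wP u uL.
  rewrite (_ : u - _ = a *: v); last by rewrite [in X in X - _]uE addrK.
  rewrite (hform_scale hg); have [k ->] := minor_eq0 vn0 (fun i j => mL i j v vL).
  by rewrite dotZ vc1 !mulr0 add0r.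
(* The difference of t and P times the Euler field vanishes on L. *)
have hG i : hform r (fun u => t u ord0 i - u ord0 i * P u).
  by apply: hformB; [exact: ht | exact: hform_below_coord].
have G0 i : {in L, forall u, t u ord0 i - u ord0 i * P u = 0}.
  apply: (hform_domain charK (hG i) (hform_dot c1) _ wL); last by rewrite wc1 oner_neq0.
  move=> u uL; have [->|uc] := eqVneq (dot u c1) 0; first by rewrite mulr0.
  have un0 : u != 0 by apply: contraNneq uc => ->; rewrite /dot mul0mx mxE.
  have [k tuE] := minor_eq0 un0 (fun i j => mL i j u uL).
  have := gE u uL; rewrite tuE dotZ mulrC => /(mulfI uc) ->.
  by rewrite mxE; ring.
have [c cP] := line_functional lL.
have [e ec] : exists e, dot e c = 1.
  have [e eL] := notin_line lL; rewrite cP in eL.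
  by exists ((dot e c)^-1 *: e); rewrite dotZ mulVf.
have proj_L u : u - dot u c *: e \in L by rewrite cP dotB dotZ ec mulr1 subrr.
(* Its quotient by the equation of L has the components Q i. *)
have [Q hQ QE] := fin_all_exists2 (fun i => hform_division c e (hG i)).
have tE u i : t u ord0 i = u ord0 i * P u + dot u c * Q i u.
  by apply/eqP; rewrite addrC -subr_eq QE G0 ?proj_L // add0r.
have mE u i j : minor (t u) u i j = dot u c * minor (\row_i Q i u) u i j.
  by rewrite /minor !tE !mxE; ring.
case: r ht rs hg hP hG hQ => [|r] ht rs hg hP hG hQ.
  (* In degree 0 the quotient is zero, so t would be radial everywhere. *)
  by case/eqP: m0; rewrite mE /minor !mxE !hQ; ring.
exists r => //; exists (fun u => \row_i Q i u); split.
- by move=> i; apply: eq_hform (hQ i) => u; rewrite mxE.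
- move=> L' /fsetD1P[L'L L'A] u uL'.
  have lL' := arrA _ L'A; have [c' c'P] := line_functional lL'.
  have [x xL' xL] : exists2 x, x \in L' & x \notin L.
    by apply/subvPn; rewrite line_notsub.
  rewrite c'P; apply/eqP; move: u uL'.
  apply: (hform_domain charK _ (hform_dot c) _ xL'); last by rewrite -cP.
    by apply: vform_dot => i; apply: eq_hform (hQ i) => u; rewrite mxE.
  move=> u uL'; have := tA _ L'A u uL'; have := uL'; rewrite !c'P => /eqP uc' /eqP.
  rewrite (_ : t u = P u *: u + dot u c *: \row_i Q i u).
    by rewrite dotD !dotZ uc' mulr0 add0r mulrC.
  by apply/rowP => i; rewrite tE !mxE mulrC.
- exists i0, j0, u0; apply: contraNneq m0; rewrite mE => ->; rewrite mulr0.
  by [].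
Qed.

Lemma log_field_addition A L r : is_line L -> log_field A r ->
  log_field (L |` A)%fset r.+1.
Proof.
move=> lL [t [ht tA [i [j [u mu]]]]]; have [c cP] := line_functional lL.
exists (fun u => dot u c *: t u); split.
- by move=> k; apply: eq_hform (hformM (hform_dot c) (ht k)) => x; rewrite mxE.
- move=> L' /fset1UP[->|L'A] x xL'; last by rewrite memvZ ?tA.
  by move: xL'; rewrite cP => /eqP ->; rewrite scale0r mem0v.
- have [e eL] := notin_line lL; rewrite cP in eL.
  have [w _ wP] := hform_mul_neq0 charK (hform_dot c) (hform_minor i j ht)
    (memvf e) (memvf u) eL mu.
  exists i, j, w; apply: contraNneq wP => <-; apply/eqP.
  by rewrite /minor !mxE; ring.
Qed.

(** The product of the equations of the lines of s. *)
Lemma defining_form (s : seq (subspace K)) : (forall L, L \in s -> is_line L) ->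
  exists g, [/\ hform (size s) g, forall L, L \in s -> {in L, forall u, g u = 0}
    & forall U, (forall L, L \in s -> ~~ (U <= L)%VS) -> exists2 u, u \in U & g u != 0].
Proof.
elim: s => [|L s IHs] ls.
  exists (fun=> 1); split=> // [|U _]; first exact: hform_const.
  by exists 0; rewrite ?mem0v ?oner_neq0.
have [|g [hg gs gU]] := IHs; first by move=> L' L's; apply: ls; rewrite inE L's orbT.
have [c cP] := line_functional (ls L (mem_head _ _)).
exists (fun u => dot u c * g u); split.
- exact: (hformM (hform_dot c) hg).
- move=> L'; rewrite inE => /predU1P[->|L's] u uL.
    by move: uL; rewrite cP => /eqP ->; rewrite mul0r.
  by rewrite (gs L') // mulr0.
- move=> U nU; have [|x xU gx] := gU U.
    by move=> L' L's; apply: nU; rewrite inE L's orbT.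
  have /subvPn[y yU yL] := nU L (mem_head _ _); rewrite cP in yL.
  exact: (hform_mul_neq0 charK (hform_dot c) hg yU xU yL gx).
Qed.

(** The constant field with value a vector of p is tangent to the lines
    through p; multiplying it by the equations of the other lines makes it
    tangent to them too. *)
Lemma log_field_point A p : is_arrangement A -> is_point p ->
  log_field A #|` [fset L in A | ~~ (p <= L)%VS]%fset|.
Proof.
move=> arrA pp; have [v vn0 pE] := is_pointP pp.
set B := [fset L in A | _]%fset.
have [L|g [hg gB gU]] := @defining_form (enum_fset B).
  by rewrite !inE /= => /andP[/arrA].
exists (fun u => g u *: v); split.
- move=> i; apply: eq_hform (hformZ (v ord0 i) hg) => u; by rewrite mxE mulrC.
- move=> L LA u uL; have [pL|pL] := boolP (p <= L)%VS.
    by rewrite memvZ // memvE -pE.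
  by rewrite (gB L) ?scale0r ?mem0v // !inE /= LA.
- have [u uf gu] : exists2 u, u \in fullv & g u != 0.
    apply: gU => L; rewrite !inE /= => /andP[/arrA lL _].
    by have [e eL] := notin_line lL; apply: contra eL => /subvP->; rewrite ?memvf.
  have [w wv] : exists w, w \notin <[v]>%VS.
    suff /subvPn[w _ wv] : ~~ ({:V} <= <[v]>)%VS by exists w.
    by apply/negP => /dimvS; rewrite dim_space dim_vline vn0.
  have [i [j mij]] := minor_neq0 vn0 wv.
  have hm : hform 1 (fun u => minor u v i j).
    apply: hformB; [have := hformZ (v ord0 j) (hform_coord K i)
                  | have := hformZ (v ord0 i) (hform_coord K j)];
    by apply: eq_hform => x; rewrite mulrC.
  have [x _ mx] := hform_mul_neq0 charK hg hm uf (memvf w) gu mij.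
  exists j, i, x; apply: contraNneq mx => <-; apply/eqP.
  by rewrite /minor !mxE; ring.
Qed.

End Fields.


(** * Fields built from two pencils *)

Section Pencils.

Variable K : fieldType.
Hypothesis charK : [pchar K] =i pred0.

Local Notation V := 'rV[K]_3.
Implicit Types (u v w e : V) (c : 'cV[K]_3) (L M p q a b : subspace K).
Implicit Types (A : {fset subspace K}) (t : V -> V).

(** F is the product of equations of lines a_i through u, and G the product
    of equations of the lines b_i joining v to the points where the a_i meet
    M. On M the lines a_i and b_i have the same zero, so adding to the
    equation of a_i a multiple of the equation of M gives an equation of
    b_i. *)
Lemma pencil_forms M u v (s : seq (subspace K)) :
    is_line M -> u \notin M -> v \notin M ->
    (forall a, a \in s -> is_line a /\ u \in a) ->
  exists F G, [/\ hform (size s) F, hform (size s) G, {in M, F =1 G},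
    forall a, a \in s -> {in a, forall x, F x = 0} &
    [/\ forall a b w, a \in s -> is_line b -> v \in b -> w != 0 -> w \in M ->
        w \in a -> w \in b -> {in b, forall x, G x = 0}
      & exists2 w, w \in M & G w != 0]].
Proof.
move=> lM uM vM; have [m mP] := line_functional lM.
have vm : dot v m != 0 by rewrite -mP.
elim: s => [_|a s IHs sa].
  exists (fun=> 1), (fun=> 1); split=> //; try exact: hform_const.
  by split=> //; exists 0; rewrite ?mem0v ?oner_neq0.
have [|F [G [hF hG FG F0 [G0 [w0 w0M Gw0]]]]] := IHs.
  by move=> a' a's; apply: sa; rewrite inE a's orbT.
have [la ua] := sa a (mem_head _ _).
have [c cP] := line_functional la.
(* The equation of a corrected by the equation m of M so that it vanishes at
   v. *)
pose d := c + (- (dot v c / dot v m)) *: m.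
have dE x : dot x d = dot x c - (dot v c / dot v m) * dot x m.
  by rewrite dotDr dotZr mulNr.
exists (fun x => dot x c * F x), (fun x => dot x d * G x); split.
- exact: (hformM (hform_dot c) hF).
- exact: (hformM (hform_dot d) hG).
- move=> x xM; rewrite dE; have := xM; rewrite mP => /eqP ->.
  by rewrite mulr0 subr0 FG.
- move=> a'; rewrite inE => /predU1P[->|a's] x xa.
    by move: xa; rewrite cP => /eqP ->; rewrite mul0r.
  by rewrite (F0 a') // mulr0.
split.
- move=> a' b w; rewrite inE => /predU1P[->|a's] lb vb wn0 wM wa wb x xb; last first.
    by rewrite (G0 a' b w) // mulr0.
  have vn0 : v != 0 by apply: contraNneq vM => ->; apply: mem0v.
  have vw : <[v]>%VS != <[w]>%VS.
    by apply: contraNneq vM => vw; rewrite memvE vw -memvE.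
  have := xb; rewrite (@line_through _ <[v]> <[w]> b) ?is_point_line -?memvE //.
  move=> /memv_addP[_ /vlineP[k ->] [_ /vlineP[l ->] ->]].
  move: wM wa; rewrite mP cP => /eqP wm /eqP wc.
  rewrite dE !dotD !dotZ wm wc.
  by field.
- have /subvPn[x xM xa] : ~~ (M <= a)%VS.
    by rewrite line_notsub //; apply: contraNneq uM => ->.
  apply: (hform_mul_neq0 charK (hform_dot d) hG xM w0M _ Gw0).
  rewrite dE; move: xM xa; rewrite mP cP => /eqP -> xc.
  by rewrite mulr0 subr0.
Qed.

(** With F and G as above and k = - m(u) / m(v), where m is the equation of
    M, the field G . u + k F . v does the job. It takes values in the line
    uv; along a_i only its part in direction u survives, along b_i only its
    part in direction v; and on M, where F = G, the equation of M takes the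
    value F (m(u) + k m(v)) = 0. *)
Lemma log_field_pencil A M u v (s : seq (subspace K)) :
    is_arrangement A -> is_line M -> u \notin M -> v \notin M -> v \notin <[u]>%VS ->
    (forall a, a \in s -> is_line a /\ u \in a) ->
    (forall L, L \in A -> [\/ L = M, u \in L /\ v \in L, L \in s
       | v \in L /\ exists a w, [/\ a \in s, w != 0, w \in M, w \in a & w \in L]]) ->
  log_field A (size s).
Proof.
move=> arrA lM uM vM vu sP AP.
have [F [G [hF hG FG F0 [G0 [w0 w0M Gw0]]]]] := pencil_forms lM uM vM sP.
have [m mP] := line_functional lM.
have vm : dot v m != 0 by rewrite -mP.
have un0 : u != 0 by apply: contraNneq uM => ->; apply: mem0v.
have vn0 : v != 0 by apply: contraNneq vM => ->; apply: mem0v.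
have uv : <[u]>%VS != <[v]>%VS by apply: contraNneq vu => ->; apply: memv_line.
pose k := - (dot u m / dot v m).
pose t x := G x *: u + (k * F x) *: v.
have ht : vform (size s) t.
  move=> i; apply: (@eq_hform _ _ (fun x => u ord0 i * G x + (k * v ord0 i) * F x)).
    by move=> x; rewrite !mxE; ring.
  by apply: hformD; apply: hformZ.
have lN : is_line (<[u]> + <[v]>)%VS.
  by rewrite /is_line dimv_disjoint_sum ?dim_vline ?un0 ?vn0 ?point_cap ?is_point_line.
have tN x : t x \in (<[u]> + <[v]>)%VS.
  by rewrite memv_add ?memvZ ?memv_line.
exists t; split=> // [L LA x xL|].
  case: (AP L LA) => [LM|[uL vL]|Ls|[vL [a [w [as_ wn0 wM wa wL]]]]].
  - move: xL; rewrite LM => xM; rewrite mP /t dotD !dotZ -FG // /k.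
    by apply/eqP; field.
  - by rewrite memvD ?memvZ.
  - by rewrite /t (F0 L) // mulr0 scale0r addr0 memvZ // (sP L Ls).2.
  - by rewrite /t (G0 a L w) ?arrA // scale0r add0r memvZ.
have [n nP] := line_functional lN.
have [e eN] := notin_line lN; rewrite nP in eN.
(* A point x off the line uv where G is nonzero. As the value of the field
   lies on the line uv, it could be radial at x only by being zero, and then
   G would be zero at x. *)
have [x _ Gx] := hform_mul_neq0 charK hG (hform_dot n) (memvf w0) (memvf e) Gw0 eN.
move: Gx; rewrite mulf_eq0 negb_or -nP => /andP[Gx xN].
have xn0 : x != 0 by apply: contraNneq xN => ->; apply: mem0v.
suff [i [j mij]] : exists i j, minor (t x) x i j != 0 by exists i, j, x.
apply: minor_neq0 => //; apply/negP => /vlineP[l tE].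
have l0 : l = 0.
  apply/eqP; apply: contraNT xN => ln0.
  by rewrite -[x]scale1r -(mulVf ln0) -scalerA memvZ // -tE.
move: tE; rewrite l0 scale0r /t => /eqP; rewrite addr_eq0 => /eqP GuE.
have : G x *: u \in <[v]>%VS by rewrite GuE -scaleNr memvZ ?memv_line.
move=> uv'; case/negP: uv; apply/eqP/point_eq; rewrite ?is_point_line //.
rewrite -memvE -[u]scale1r -(mulVf Gx) -scalerA.
exact: memvZ.
Qed.

End Pencils.

(** * Syzygies of the equation as tangent fields *)

Section Syzygies.

Variable K : fieldType.
Hypothesis charK : [pchar K] =i pred0.

Local Notation V := 'rV[K]_3.
Implicit Types (u v w e : V) (c : 'cV[K]_3) (L : subspace K).
Implicit Types (A : {fset subspace K}) (f l : {mpoly K[3]}).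

Definition derivation (a : 'I_3 -> {mpoly K[3]}) f := \sum_(i < 3) a i * f^`M(i).

Lemma derivationM a f g : derivation a (f * g) = derivation a f * g + f * derivation a g.
Proof.
rewrite /derivation mulr_suml mulr_sumr -big_split /=; apply: eq_bigr => i _.
by rewrite mderivM; ring.
Qed.

Lemma derivation_prod a (I : eqType) (s : seq I) (l g : I -> {mpoly K[3]}) :
    (forall i, i \in s -> derivation a (l i) = g i * l i) ->
  derivation a (\prod_(i <- s) l i) = (\sum_(i <- s) g i) * \prod_(i <- s) l i.
Proof.
elim: s => [_|i s IHs lP].
  rewrite !big_nil mul0r /derivation big1 // => i _.
  by rewrite -[1]/(1%:MP) mderivC mulr0.
rewrite !big_cons derivationM IHs; last by move=> j js; apply: lP; rewrite inE js orbT.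
by rewrite lP ?mem_head //; ring.
Qed.

Lemma linear_mderiv l i : l \is 1.-homog -> l^`M(i) = (l@_U_(i))%:MP.
Proof.
move=> hl; apply/mpolyP => m; rewrite mcoeff_deriv mcoeffC.
have [->|mn0] := eqVneq m 0%MM; first by rewrite mulr1 mnm0E add0m mulr1n.
rewrite (dhomog_nemf_coeff hl) ?mul0rn ?mulr0 //=.
by rewrite mdegD mdeg1 -[X in _ != X]/(0 + 1)%N eqn_add2r mdeg_eq0.
Qed.

Lemma linearE l : l \is 1.-homog -> l = \sum_(i < 3) l@_U_(i) *: 'X_i.
Proof.
move=> hl; apply/mpolyP => m; rewrite linear_sum /=.
under eq_bigr do rewrite mcoeffZ mcoeffX.
have [m1|m1] := boolP (mdeg m == 1%N); last first.
  rewrite (dhomog_nemf_coeff hl m1) big1 // => i _.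
  by case: eqP => [mi|_]; rewrite ?mulr0 //; move: m1; rewrite -mi mdeg1.
case/mdeg1P: m1 => j /eqP ->; rewrite (bigD1 j) //= eqxx mulr1 big1 ?addr0 // => i ij.
by rewrite eq_mnm1 (negPf ij) mulr0.
Qed.

Lemma meval_sum (I : Type) (s : seq I) (F : I -> {mpoly K[3]}) (x : 'I_3 -> K) :
  (\sum_(i <- s) F i).@[x] = \sum_(i <- s) (F i).@[x].
Proof.
by elim: s => [|i s IHs]; rewrite ?big_nil ?meval0 // !big_cons mevalD IHs.
Qed.

Lemma meval_prod (I : Type) (s : seq I) (F : I -> {mpoly K[3]}) (x : 'I_3 -> K) :
  (\prod_(i <- s) F i).@[x] = \prod_(i <- s) (F i).@[x].
Proof.
by elim: s => [|i s IHs]; rewrite ?big_nil ?meval1 // !big_cons mevalM IHs.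
Qed.

Lemma linear_eval l (v : V) : l \is 1.-homog ->
  l.@[v ord0] = dot v (\col_i l@_U_(i)).
Proof.
move=> hl; rewrite dotE {1}(linearE hl) meval_sum; apply: eq_bigr => i _.
by rewrite mevalZ mevalXU mxE mulrC.
Qed.

Lemma derivation_linear a l : l \is 1.-homog ->
  derivation a l = \sum_(i < 3) l@_U_(i) *: a i.
Proof.
move=> hl; apply: eq_bigr => i _.
by rewrite linear_mderiv // mulrC mul_mpolyC.
Qed.

Lemma derivation_linear_eval (a : 'I_3 -> {mpoly K[3]}) l (v : V) : l \is 1.-homog ->
  (derivation a l).@[v ord0] = dot (\row_i (a i).@[v ord0]) (\col_i l@_U_(i)).
Proof.
move=> hl; rewrite derivation_linear // meval_sum dotE; apply: eq_bigr => i _.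
by rewrite mevalZ !mxE mulrC.
Qed.

Variables (A : {fset subspace K}) (f : {mpoly K[3]}).
Hypotheses (arrA : is_arrangement A) (A_f : is_equation A f).

Lemma euler_identity : derivation (fun i => 'X_i) f = #|` A|%:R *: f.
Proof.
case: A_f => l lP ->.
rewrite (@derivation_prod _ _ _ l (fun=> 1)) => [|L LA].
  by rewrite big_const_seq count_predT iter_addr_0 mulr_natl scaler_nat.
have [hl _] := lP L LA.
by rewrite derivation_linear // mul1r -linearE.
Qed.

Lemma equation_neq0 : exists u : V, f.@[u ord0] != 0.
Proof.
case: A_f => l lP ->.
have [||u _ fu] := @hform_prod_neq0 _ charK fullv _ (enum_fset A) (fun L u => (l L).@[u ord0]).
- by move=> L /lP[hl _]; exists (l L).
- move=> L LA; have [_ lE] := lP L LA; have [e eL] := notin_line (arrA LA).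
  by exists e; rewrite ?memvf // -lE.
by exists u; rewrite meval_prod.
Qed.

Lemma equation_hform : hform #|` A| (fun u : V => f.@[u ord0]).
Proof.
case: A_f => l lP ->; have := @hform_prod _ _ (enum_fset A) (fun L u => (l L).@[u ord0]).
move=> H; apply: eq_hform (H _) => [u|L /lP[hl _]]; first by rewrite meval_prod.
by exists (l L).
Qed.

(** Write f = l g with l the equation of L. Applying the derivation gives
    a(l) g + l a(g) = 0, hence a(l) g = 0 on L, where g does not vanish
    identically because the lines are distinct. *)
Lemma syzygy_preserves (a : 'I_3 -> {mpoly K[3]}) r L :
    (forall i, a i \is r.-homog) -> derivation a f = 0 -> L \in A ->
  forall u : V, u \in L -> \row_i (a i).@[u ord0] \in L.
Proof.
move=> ha; case: A_f => l lP -> af LA u uL.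
have [hl lE] := lP L LA.
move: af; rewrite (big_fsetD1 L LA) /=.
set g := \prod_(_ <- _) _; rewrite derivationM => af.
have hg : hform (size (enum_fset (A `\ L)%fset)) (fun u : V => g.@[u ord0]).
  apply: (@eq_hform _ _ (fun u : V => \prod_(L' <- (A `\ L)%fset) (l L').@[u ord0])).
    by move=> x; rewrite meval_prod.
  by apply: hform_prod => L' /fsetD1P[_ /lP[hl' _]]; exists (l L').
have [||w wL gw] := @hform_prod_neq0 _ charK L _ (enum_fset (A `\ L)%fset)
    (fun L u => (l L).@[u ord0]).
- by move=> L' /fsetD1P[_ /lP[hl' _]]; exists (l L').
- move=> L' /fsetD1P[L'L L'A]; have [_ lE'] := lP L' L'A.
  have /subvPn[e eL eL'] : ~~ (L <= L')%VS by rewrite line_notsub ?arrA // eq_sym.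
  by exists e; rewrite // -lE'.
rewrite lE linear_eval // -derivation_linear_eval //; apply/eqP; move: u uL.
apply: (hform_domain charK _ hg _ wL); last by rewrite meval_prod.
  apply: (@eq_hform _ _ (fun x : V => dot (\row_i (a i).@[x ord0]) (\col_i (l L)@_U_(i)))).
    by move=> x; rewrite -derivation_linear_eval.
  by apply: vform_dot => i; exists (a i) => // x; rewrite mxE.
move=> u uL; have := congr1 (fun p => p.@[u ord0]) af.
by rewrite mevalD !mevalM meval0; have := uL; rewrite lE => /eqP ->; rewrite mul0r addr0.
Qed.

(** If the syzygy were radial, of the form P times the Euler field, then
    Euler's identity would give d P f = 0. *)
Lemma syzygy_log_field r : A != fset0 -> has_syzygy f r -> log_field A r.
Proof.
move=> An0 [a [ha [j aj0] af]].
exists (fun u => \row_i (a i).@[u ord0]); split.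
- by move=> i; exists (a i) => // u; rewrite mxE.
- by move=> L LA; apply: syzygy_preserves.
apply: NNPP => rad; case/eqP: aj0; apply: mpoly_eval_eq0 => // u.
have aE i j' (v : V) : (a i).@[v ord0] * v ord0 j' = (a j').@[v ord0] * v ord0 i.
  apply/eqP; rewrite -subr_eq0; apply/negPn/negP => mn0; case: rad.
  by exists i, j', v; rewrite /minor !mxE.
have [w fw] := equation_neq0.
move: u (memvf u).
apply: (hform_domain charK _ equation_hform _ (memvf w)) => // [|u _].
  by exists (a j).
have d0 : (#|` A|%:R : K) != 0 by rewrite natr_eq0_char0 // cardfs_eq0.
apply/eqP; rewrite -(mulrI_eq0 _ (mulfI d0)) mulrCA -mevalZ -euler_identity; apply/eqP.
rewrite meval_sum mulr_sumr -[RHS](mulr0 (u ord0 j)) -[X in _ = _ * X](meval0 (u ord0)).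
rewrite -af meval_sum mulr_sumr; apply: eq_bigr => i _.
by rewrite !mevalM mevalXU !mulrA aE [u ord0 j * _]mulrC.
Qed.

Lemma derivation_prod_ex a (P : {mpoly K[3]} -> Prop) (I : eqType) (s : seq I)
    (l : I -> {mpoly K[3]}) :
    P 0 -> (forall g h, P g -> P h -> P (g + h)) ->
    (forall i, i \in s -> exists2 g, P g & derivation a (l i) = g * l i) ->
  exists2 g, P g & derivation a (\prod_(i <- s) l i) = g * \prod_(i <- s) l i.
Proof.
move=> P0 PD; elim: s => [_|i s IHs lP].
  exists 0; rewrite // !big_nil mul0r /derivation big1 // => i _.
  by rewrite -[1]/(1%:MP) mderivC mulr0.
have [|g Pg gE] := IHs; first by move=> j js; apply: lP; rewrite inE js orbT.
have [h Ph hE] := lP i (mem_head _ _).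
by exists (h + g); rewrite ?big_cons ?derivationM ?gE ?hE; [exact: PD | ring].
Qed.

(** A tangent field maps every equation l to a multiple of l, hence f to a
    multiple g f. Subtracting g / d times the Euler field, which maps f to d
    f, leaves a syzygy. *)
Lemma log_field_syzygy r : A != fset0 -> log_field A r -> has_syzygy f r.
Proof.
move=> An0 [t [ht tA [i0 [j0 [u0 m0]]]]].
have [p hp pE] := fin_all_exists2 ht.
pose P (g : {mpoly K[3]}) := forall i, g * 'X_i \is r.-homog.
have [g Pg gE] : exists2 g, P g & derivation p f = g * f.
  case: A_f => l lP ->; apply: derivation_prod_ex => [i|g h Pg Ph i|L LA].
  - by rewrite mul0r dhomog0.
  - by rewrite mulrDl rpredD.
  have [hl lE] := lP L LA; set c := \col_i (l L)@_U_(i).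
  have lcE u : (l L).@[u ord0] = dot u c by apply: linear_eval.
  have [e eL] := notin_line (arrA LA).
  have ec : dot e c != 0 by rewrite -lcE -lE.
  have [Q hQ QE] := hform_division c ((dot e c)^-1 *: e) (vform_dot c ht).
  have {}QE u : dot (t u) c = dot u c * Q u.
    rewrite {1}QE (_ : dot (t _) c = 0) ?add0r //; apply/eqP.
    by rewrite -lcE -lE tA // lE lcE dotB !dotZ mulVf // mulr1 subrr.
  (* The condition P makes sense of the degree r - 1 uniformly: in degree 0
     the cofactor is zero. *)
  have [g Pg gE] : exists2 g : {mpoly K[3]}, P g & forall u : V, Q u = g.@[u ord0].
    case: r @P {ht hp} hQ => [|r] P /= hQ.
      by exists 0 => [i|u]; rewrite ?mul0r ?dhomog0 // meval0 hQ.
    case: hQ => g hg gE; exists g => // i.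
    by rewrite mulrC (@dhomogM _ _ _ 1) // dhomogX /= mdeg1.
  exists g => //; apply: mpoly_eval_inj => // u.
  rewrite derivation_linear_eval // mevalM -gE lcE mulrC -QE; congr (dot _ _).
  by apply/rowP => i; rewrite mxE pE.
have d0 : (#|` A|%:R : K) != 0 by rewrite natr_eq0_char0 // cardfs_eq0.
pose k := (#|` A|%:R : K)^-1.
exists (fun i => p i - k *: (g * 'X_i)); split=> [i||].
- by rewrite rpredB // dhomogZ.
- apply/existsP; rewrite -negb_forall; apply: contra m0 => /forallP a0.
  have tE i u : t u ord0 i = k * (g.@[u ord0] * u ord0 i).
    have := a0 i; rewrite subr_eq0 => /eqP piE; rewrite pE piE.
    by rewrite mevalZ mevalM mevalXU.
  by rewrite /minor !tE; apply/eqP; ring.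
- have df0 : derivation p f - k *: (g * derivation (fun i => 'X_i) f) = 0.
    by rewrite gE euler_identity -scalerAr scalerA mulVf // scale1r subrr.
  rewrite -[RHS]df0 /derivation mulr_sumr scaler_sumr -sumrB; apply: eq_bigr => i _.
  by rewrite mulrBl mulrA -scalerAl.
Qed.

Lemma min_syzygy_degreeP r : A != fset0 -> log_field A r ->
  (forall s, log_field A s -> (r <= s)%N) -> min_syzygy_degree f r.
Proof.
move=> An0 Ar minr; split; first exact: log_field_syzygy.
by move=> s /(syzygy_log_field An0)/minr.
Qed.

End Syzygies.


(** * Degree bounds from triple points *)

Section Bounds.

Variable K : fieldType.
Hypothesis charK : [pchar K] =i pred0.

Local Notation V := 'rV[K]_3.
Implicit Types (L M p q : subspace K) (A B P : {fset subspace K}).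

Definition max_triple A := forall p, is_point p -> (multiplicity A p <= 3)%N.

Definition triple_points A P := forall p, (p \in P) = triple_point A p.

Lemma arrangement_sub A B : (B `<=` A)%fset -> is_arrangement A -> is_arrangement B.
Proof. by move=> /fsubsetP sBA arrA L /sBA/arrA. Qed.

Lemma card_fset_filter A (Q : pred (subspace K)) :
  #|` [fset L in A | Q L]%fset| = count Q (enum_fset A).
Proof. by rewrite -!sum1_size big_fset /= sum1_count. Qed.

Lemma multiplicityE A p : multiplicity A p = count (fun L => (p <= L)%VS) (enum_fset A).
Proof. exact: card_fset_filter. Qed.

Lemma multiplicity_sub A B p : (B `<=` A)%fset -> (multiplicity B p <= multiplicity A p)%N.
Proof.
move=> /fsubsetP sBA; apply/fsubset_leq_card/fsubsetP => L.
by rewrite !inE /= => /andP[/sBA -> ->].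
Qed.

Lemma multiplicityD1 A L p : L \in A ->
  multiplicity A p = ((p <= L)%VS + multiplicity (A `\ L)%fset p)%N.
Proof.
move=> LA; rewrite !multiplicityE -!sum1_count !(big_mkcond (fun L' => (p <= L')%VS)) /=.
by rewrite (big_fsetD1 L LA) /=; case: (p <= L)%VS.
Qed.

Lemma max_triple_sub A B : (B `<=` A)%fset -> max_triple A -> max_triple B.
Proof. by move=> sBA mA p /mA; apply/leq_trans/multiplicity_sub. Qed.

Lemma triple_pointsD1 A L P : L \in A -> max_triple A -> triple_points A P ->
  triple_points (A `\ L)%fset [fset p in P | ~~ (p <= L)%VS]%fset.
Proof.
move=> LA mA PA p; rewrite !inE /= PA /triple_point /has_multiplicity.
case pp : (is_point p) => //=; have := mA p pp; rewrite (multiplicityD1 _ LA).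
by case: (p <= L)%VS => /=; rewrite ?andbT ?andbF ?add0n //; case: eqP => // ->.
Qed.

Lemma log_field_extend A B r : (B `<=` A)%fset -> is_arrangement A ->
  log_field B r -> log_field A (r + #|` (A `\` B)%fset|).
Proof.
move=> sBA arrA Br; move: {2}#|` _| (erefl #|` (A `\` B)%fset|) => n.
elim: n A sBA arrA => [|n IHn] A sBA arrA cn.
  rewrite cn addn0; suff -> : A = B by [].
  by apply/eqP; rewrite eqEfsubset sBA andbT -fsetD_eq0 -cardfs_eq0 cn.
have /fset0Pn[L] : (A `\` B)%fset != fset0 by rewrite -cardfs_eq0 cn.
rewrite inE => /andP[LB LA].
rewrite cn addnS -(fsetD1K LA); apply: log_field_addition => //; first exact: arrA.
have <- : #|` ((A `\ L) `\` B)%fset| = n.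
  have : L \in (A `\` B)%fset by rewrite inE LB.
  move=> LAB; have := cardfsD1 L (A `\` B)%fset; rewrite LAB cn => -[->].
  by congr #|` _|; rewrite fsetDDl fsetUC -fsetDDl.
apply: IHn; last 1 first.
- have LAB : L \in (A `\` B)%fset by rewrite inE LB.
  have := cardfsD1 L (A `\` B)%fset; rewrite LAB cn => -[->].
  by congr #|` _|; rewrite !fsetDDl fsetUC.
- by apply/fsubsetP => x xB; rewrite !inE (fsubsetP sBA) // andbT; apply: contraNneq LB => <-.
- exact: arrangement_sub (fsubD1set _ _) arrA.
Qed.

Lemma log_field_multiplicity A p : is_arrangement A -> is_point p ->
  log_field A (#|` A| - multiplicity A p).
Proof.
move=> arrA pp; have := log_field_point charK arrA pp.
suff -> : #|` [fset L in A | ~~ (p <= L)%VS]%fset| = (#|` A| - multiplicity A p)%N by [].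
rewrite multiplicityE -(count_predC (fun L => (p <= L)%VS) (enum_fset A)) addKn.
by rewrite card_fset_filter.
Qed.

(** A point of L on m lines of A is met by m - 1 of the other lines, which
    is at most 1, or 2 at a triple point. *)
Lemma line_points_card A L P : is_arrangement A -> max_triple A -> triple_points A P ->
    L \in A ->
  (#|` A|.-1 <= #|` [fset (L :&: L')%VS | L' in (A `\ L)%fset]%fset|
                + #|` [fset p in P | (p <= L)%VS]%fset|)%N.
Proof.
move=> arrA mA PA LA; set pts := [fset _ | _ in _]%fset.
rewrite (cardfsD1 L) LA /= -sum1_size (partition_big_imfset _ (fun L' => L :&: L')%VS) /=.
apply: (@leq_trans (\sum_(q <- pts) (1 + (q \in P)))); last first.
  rewrite big_split /= sum1_size leq_add2l.
  have -> : (\sum_(q <- pts) (q \in P) = #|` [fset q in pts | q \in P]%fset|)%N.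
    by rewrite card_fset_filter -sum1_count [RHS]big_mkcond; apply: eq_bigr => q _; case: ifP.
  apply/fsubset_leq_card/fsubsetP => q; rewrite !inE /= => /andP[+ ->].
  by case/imfsetP => L' _ ->; rewrite capvSl.
rewrite big_seq [leqRHS]big_seq; apply: leq_sum => q /imfsetP[L' /=].
rewrite !inE => /andP[L'L L'A] qE.
have qp : is_point q by rewrite qE line_cap ?arrA // eq_sym.
have qL : (q <= L)%VS by rewrite qE capvSl.
rewrite sum1_count; apply: (@leq_trans (multiplicity (A `\ L)%fset q)).
  by rewrite multiplicityE; apply: sub_count => M /eqP <-; apply: capvSr.
have := mA q qp; rewrite PA /triple_point /has_multiplicity qp /=.
by rewrite (multiplicityD1 _ LA) qL; case: (multiplicity _ q) => [|[|[|]]].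
Qed.

(** A field of degree r either comes from the deletion of L, or r + 1 is at
    least the number of points on L. *)
Lemma deletion_bound A L P s r : is_arrangement A -> max_triple A -> triple_points A P ->
    L \in A -> (forall r', log_field (A `\ L)%fset r' -> (s <= r')%N) -> log_field A r ->
  (minn s.+1 (#|` A| - 2 - #|` [fset p in P | (p <= L)%VS]%fset|) <= r)%N.
Proof.
move=> arrA mA PA LA sP Ar; have := line_points_card arrA mA PA LA.
set pts := [fset _ | _ in _]%fset => cpts.
have [rpts|] := ltnP r.+1 #|` pts|; last by lia.
have [|r' -> /sP] := log_field_deletion charK arrA LA (fset_uniq pts) rpts _ Ar; last by lia.
move=> q /imfsetP[L' /=]; rewrite !inE => /andP[L'L L'A] ->; split.
- by rewrite line_cap ?arrA // eq_sym.
- exact: capvSl.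
- by exists L'; rewrite L'L L'A capvSr.
Qed.

Lemma triple_lines_card A p : triple_point A p ->
  #|` [fset L in A | (p <= L)%VS]%fset| = 3%N.
Proof. by case/andP => _ /eqP. Qed.

(** If each line of A through p contains a second triple point q, it is p +
    q. *)
Lemma extra_lines A P p : is_arrangement A -> triple_points A P -> p \in P ->
    (forall L, L \in A -> (p <= L)%VS -> exists q, [/\ q \in P, q != p & (q <= L)%VS]) ->
  ([fset L in A | (p <= L)%VS] `<=` [fset (p + q)%VS | q in (P `\ p)])%fset.
Proof.
move=> arrA PA pP ex; apply/fsubsetP => L; rewrite !inE /= => /andP[LA pL].
have [q [qP qp qL]] := ex L LA pL; apply/imfsetP; exists q => /=.
  by rewrite !inE qp.
have [/andP[pp _] /andP[qq _]] : triple_point A p /\ triple_point A q by rewrite -!PA.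
by apply: line_through; rewrite ?arrA // eq_sym.
Qed.

(** With at most two other triple points, the three lines through a triple
    point cannot all contain one of them. *)
Lemma exists_sole A P : is_arrangement A -> triple_points A P ->
    (0 < #|` P| <= 3)%N ->
  exists p L, [/\ p \in P, L \in A, (p <= L)%VS
    & forall q, q \in P -> (q <= L)%VS -> q = p].
Proof.
move=> arrA PA /andP[/[!cardfs_gt0] /fset0Pn[p pP] P3].
apply: NNPP => none.
have ex L : L \in A -> (p <= L)%VS -> exists q, [/\ q \in P, q != p & (q <= L)%VS].
  move=> LA pL; apply: NNPP => noq; case: none; exists p, L; split=> // q qP qL.
  by apply/eqP/negPn/negP => qp; case: noq; exists q.
have := fsubset_leq_card (extra_lines arrA PA pP ex).
have cim : (#|` [fset (p + q)%VS | q in (P `\ p)]%fset| <= #|` (P `\ p)%fset|)%N.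
  exact: leq_imfset_card.
rewrite triple_lines_card -?PA // => /leq_trans/(_ cim).
by have := cardfsD1 p P; rewrite pP; lia.
Qed.

Lemma card_triples_split P L :
  #|` P| = (#|` [fset p in P | (p <= L)%VS]%fset| + #|` [fset p in P | ~~ (p <= L)%VS]%fset|)%N.
Proof.
rewrite -(count_predC (fun p => (p <= L)%VS) (enum_fset P)).
by rewrite !card_fset_filter.
Qed.

Lemma card_sole P p L : p \in P -> (p <= L)%VS ->
    (forall q, q \in P -> (q <= L)%VS -> q = p) ->
  #|` [fset q in P | (q <= L)%VS]%fset| = 1%N.
Proof.
move=> pP pL sole; rewrite -[RHS](cardfs1 p); congr #|` _|; apply/fsetP => q.
rewrite !inE /=; apply/andP/eqP => [[]|->//]; exact: sole.
Qed.

(** Every line of A meets the others in d - 1 distinct points, so lines can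
    be removed one at a time. *)
Lemma degree_bound_no_triple A r : is_arrangement A -> max_triple A -> triple_points A fset0 ->
  log_field A r -> (#|` A| - 2 <= r)%N.
Proof.
move: {2}#|` A| (leqnn #|` A|) => n; elim: n A r => [|n IHn] A r An arrA mA PA Ar.
  by lia.
have [->|/fset0Pn[L LA]] := eqVneq A fset0; first by rewrite cardfs0.
have sA : (A `\ L `<=` A)%fset by rewrite fsubD1set.
have cA : #|` A| = #|` (A `\ L)%fset|.+1 by rewrite (cardfsD1 L) LA.
have P0 Q : [fset p in (fset0 : {fset subspace K}) | Q p]%fset = fset0.
  by apply/fsetP => p; rewrite !inE.
have sP r' : log_field (A `\ L)%fset r' -> (#|` (A `\ L)%fset| - 2 <= r')%N.
  move=> Ar'; apply: IHn => //; first by lia.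
  - exact: arrangement_sub arrA.
  - exact: max_triple_sub mA.
  - by have := triple_pointsD1 LA mA PA; rewrite P0.
by have := deletion_bound arrA mA PA LA sP Ar; rewrite P0 cardfs0; lia.
Qed.

(** Removing a line with a single triple point leaves one triple point less
    and d - 2 points on the line. *)
Lemma degree_bound_few_triples A P r : is_arrangement A -> max_triple A -> triple_points A P ->
  (#|` P| <= 3)%N -> log_field A r -> (#|` A| - 3 <= r)%N.
Proof.
move: {2}#|` P| (erefl #|` P|) => n; elim: n A P r => [|n IHn] A P r Pn arrA mA PA P3 Ar.
  by rewrite (cardfs0_eq Pn) in PA; have := degree_bound_no_triple arrA mA PA Ar; lia.
have [|p [L [pP LA pL sole]]] := exists_sole arrA PA; first by rewrite P3 Pn.
have cA : #|` A| = #|` (A `\ L)%fset|.+1 by rewrite (cardfsD1 L) LA.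
have c1 := card_sole pP pL sole.
have cP := card_triples_split P L.
have sP r' : log_field (A `\ L)%fset r' -> (#|` (A `\ L)%fset| - 3 <= r')%N.
  move=> Ar'; apply: (IHn _ [fset p in P | ~~ (p <= L)%VS]%fset) => //; try by lia.
  - by apply: arrangement_sub arrA; rewrite fsubD1set.
  - by apply: max_triple_sub mA; rewrite fsubD1set.
  - exact: triple_pointsD1.
by have := deletion_bound arrA mA PA LA sP Ar; rewrite c1; lia.
Qed.

End Bounds.


(** * Lines given by coordinates *)

Section Lines.

Variable K : fieldType.
Hypothesis charK : [pchar K] =i pred0.

Local Notation V := 'rV[K]_3.
Implicit Types (L M p q : subspace K) (A B C P : {fset subspace K}).

Definition vec (a b c : K) : V := \row_i [:: a; b; c]`_i.

Lemma mem_line_vec a b c x y z : (vec x y z \in line a b c) = (a * x + b * y + c * z == 0).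
Proof. by rewrite mem_line !mxE !inordK. Qed.

Lemma vecP (u : V) : exists x y z, u = vec x y z.
Proof.
exists (u ord0 (inord 0)), (u ord0 (inord 1)), (u ord0 (inord 2)).
apply/rowP => i; rewrite mxE.
by case: i => -[|[|[|]]] // lt3 /=; congr (u _ _); apply/val_inj; rewrite /= inordK.
Qed.

Lemma vec_eq0 x y z : (vec x y z == 0) = [&& x == 0, y == 0 & z == 0].
Proof.
apply/eqP/and3P => [/rowP v0|[/eqP -> /eqP -> /eqP ->]].
  have := (v0 (inord 0), v0 (inord 1), v0 (inord 2)).
  by rewrite !mxE !inordK //= => -[[-> ->] ->].
by apply/rowP => -[[|[|[|]]] // lt3]; rewrite !mxE.
Qed.

Lemma is_line_line (a b c : K) : vec a b c != 0 -> is_line (line a b c).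
Proof.
move=> n0; rewrite /is_line [line a b c]/(lker _); set f := linfun _.
have := limg_ker_dim f fullv; rewrite capfv dim_space => dE.
suff d1 : \dim (f @: fullv)%VS = 1%N by move: dE; rewrite d1 addn1 => -[->].
apply/eqP; rewrite eqn_leq; apply/andP; split.
  by apply: leq_trans (dimvS (subvf _)) _; rewrite dimvf /dim /= mul1n.
rewrite lt0n dimv_eq0; apply: contra n0 => /eqP f0.
have l0 u : u \in line a b c.
  by rewrite memv_ker -memv0 -f0 memv_img ?memvf.
have := (l0 (vec 1 0 0), l0 (vec 0 1 0), l0 (vec 0 0 1)).
rewrite !mem_line_vec !mulr0 !mulr1 !add0r !addr0 vec_eq0.
by case=> -[-> ->] ->.
Qed.

Lemma line_neq (a b c a' b' c' : K) :
  (a * b' - b * a' != 0) || (a * c' - c * a' != 0) || (b * c' - c * b' != 0) ->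
  line a b c != line a' b' c'.
Proof.
apply: contraTneq => lE.
have lz x y z : a * x + b * y + c * z = 0 -> a' * x + b' * y + c' * z = 0.
  by move=> /eqP; rewrite -mem_line_vec lE mem_line_vec => /eqP.
have e1 : a' * b + b' * - a + c' * 0 = 0 by apply: lz; ring.
have e2 : a' * c + b' * 0 + c' * - a = 0 by apply: lz; ring.
have e3 : a' * 0 + b' * c + c' * - b = 0 by apply: lz; ring.
rewrite !negb_or !negbK; apply/andP; split; first (apply/andP; split); apply/eqP.
- by rewrite -[RHS]oppr0 -e1; ring.
- by rewrite -[RHS]oppr0 -e2; ring.
- by rewrite -[RHS]oppr0 -e3; ring.
Qed.

Definition det3 (R : comPzRingType) (s t r : R * R * R) : R :=
  let: (a, b, c) := s in let: (a', b', c') := t in let: (a'', b'', c'') := r in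
  a * (b' * c'' - c' * b'') - b * (a' * c'' - c' * a'') + c * (a' * b'' - b' * a'').

Definition concurrent L1 L2 L3 := (L1 :&: L2 :&: L3 != 0)%VS.

Lemma concurrentP L1 L2 L3 :
  reflect (exists u, [/\ u != 0, u \in L1, u \in L2 & u \in L3]) (concurrent L1 L2 L3).
Proof.
apply: (iffP idP) => [c|[u [un0 u1 u2 u3]]].
  exists (vpick (L1 :&: L2 :&: L3)%VS).
  have : vpick (L1 :&: L2 :&: L3)%VS != 0 by rewrite vpick0.
  by have := memv_pick (L1 :&: L2 :&: L3)%VS; rewrite !memv_cap => /andP[/andP[-> ->] ->].
by apply: contraNneq un0 => c0; rewrite -memv0 -c0 !memv_cap u1 u2.
Qed.

Definition lineZ (t : int * int * int) : subspace K :=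
  let: (a, b, c) := t in line a%:~R b%:~R c%:~R.

Definition independent (s t : int * int * int) :=
  let: (a, b, c) := s in let: (a', b', c') := t in
  (a * b' - b * a' != 0) || (a * c' - c * a' != 0) || (b * c' - c * b' != 0).

Lemma intr_eq0_char0 (m : int) : (m%:~R == 0 :> K) = (m == 0).
Proof.
case: m => n; first by rewrite -pmulrn natr_eq0_char0 //.
by rewrite NegzE mulrNz oppr_eq0 -pmulrn natr_eq0_char0.
Qed.

Lemma lineZ_neq s t : independent s t -> lineZ s != lineZ t.
Proof.
case: s => [[a b] c]; case: t => [[a' b'] c'] ind; apply: line_neq.
by rewrite -!intrM -!intrB !intr_eq0_char0.
Qed.

(** A determinant criterion in which the coefficients are integers, so that
    the concurrences of an explicit arrangement are found by computation. *)
Lemma concurrent_lineZ s t r : independent s t ->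
  concurrent (lineZ s) (lineZ t) (lineZ r) = (det3 s t r == 0).
Proof.
case: s => [[a b] c]; case: t => [[a' b'] c']; case: r => [[a'' b''] c''] ind.
rewrite /det3 -intr_eq0_char0; apply/concurrentP/eqP.
- case=> u []; have [x [y [z ->]]] := vecP u; rewrite !mem_line_vec vec_eq0.
  move=> xyz /eqP e1 /eqP e2 /eqP e3; apply/eqP; apply: contraNT xyz => d0.
  set d := _%:~R in d0.
  have dE : d = a%:~R * (b'%:~R * c''%:~R - c'%:~R * b''%:~R)
     - b%:~R * (a'%:~R * c''%:~R - c'%:~R * a''%:~R)
     + c%:~R * (a'%:~R * b''%:~R - b'%:~R * a''%:~R).
    by rewrite /d !(intrD, intrB, intrM) //; ring.
  have dx : d * x = 0.
    (* Cramer's rule: the cofactors combine the three equations into the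
       determinant times one coordinate. *)
    pose A1 : K := b'%:~R * c''%:~R - c'%:~R * b''%:~R.
    pose A2 : K := c%:~R * b''%:~R - b%:~R * c''%:~R.
    pose A3 : K := b%:~R * c'%:~R - c%:~R * b'%:~R.
    rewrite -[RHS](_ : A1 * 0 + A2 * 0 + A3 * 0 = 0); last by ring.
    by rewrite -{1}e1 -{1}e2 -e3 dE /A1 /A2 /A3; ring.
  have dy : d * y = 0.
    pose A1 : K := c'%:~R * a''%:~R - a'%:~R * c''%:~R.
    pose A2 : K := a%:~R * c''%:~R - c%:~R * a''%:~R.
    pose A3 : K := c%:~R * a'%:~R - a%:~R * c'%:~R.
    rewrite -[RHS](_ : A1 * 0 + A2 * 0 + A3 * 0 = 0); last by ring.
    by rewrite -{1}e1 -{1}e2 -e3 dE /A1 /A2 /A3; ring.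
  have dz : d * z = 0.
    pose A1 : K := a'%:~R * b''%:~R - b'%:~R * a''%:~R.
    pose A2 : K := b%:~R * a''%:~R - a%:~R * b''%:~R.
    pose A3 : K := a%:~R * b'%:~R - b%:~R * a'%:~R.
    rewrite -[RHS](_ : A1 * 0 + A2 * 0 + A3 * 0 = 0); last by ring.
    by rewrite -{1}e1 -{1}e2 -e3 dE /A1 /A2 /A3; ring.
  move/eqP: dx; move/eqP: dy; move/eqP: dz; rewrite !mulf_eq0 (negPf d0) /=.
  by move=> -> -> ->.
(* The intersection of the first two lines is given by the vector product. *)
- move=> d0; exists (vec (b * c' - c * b')%:~R (c * a' - a * c')%:~R (a * b' - b * a')%:~R).
  split.
  + rewrite vec_eq0 !intr_eq0_char0; move: ind; rewrite /independent -!negb_and.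
    apply: contra => /and3P[-> + ->]; rewrite andbT /= => /eqP e; apply/eqP.
    by rewrite -[RHS]oppr0 -e; ring.
  + by rewrite mem_line_vec -!intrM -!intrD intr_eq0_char0; apply/eqP; ring.
  + by rewrite mem_line_vec -!intrM -!intrD intr_eq0_char0; apply/eqP; ring.
  + rewrite mem_line_vec -!intrM -!intrD; apply/eqP; rewrite -d0; congr (_%:~R); ring.
Qed.

End Lines.


(** * Complete quadrilaterals and generic lines *)

Section Quadrilaterals.

Variable K : fieldType.
Hypothesis charK : [pchar K] =i pred0.

Local Notation V := 'rV[K]_3.
Implicit Types (L M p q : subspace K) (A B C P : {fset subspace K}).

Lemma is_line_add p q : is_point p -> is_point q -> p != q -> is_line (p + q)%VS.
Proof.
move=> pp qp pq; rewrite /is_line dimv_disjoint_sum ?(eqP pp) ?(eqP qp) //.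
exact: point_cap.
Qed.

(** The complete quadrilateral with the four given vertices; the order of
    the sides is the one in which [A223] lists its lines. *)
Definition quad_lines p1 p2 p3 p4 : seq (subspace K) :=
  [:: p1 + p2; p3 + p4; p1 + p3; p2 + p4; p1 + p4; p2 + p3]%VS.

(** A line p1 p2, which is meant to contain p3 as well, and the six lines
    joining p1, p2 and p3 to p4 and p5. *)
Definition seven_lines p1 p2 p3 p4 p5 : seq (subspace K) :=
  [:: p1 + p2; p1 + p4; p2 + p4; p3 + p4; p1 + p5; p2 + p5; p3 + p5]%VS.

(** The construction of [log_field_pencil] in terms of points: s lists the
    points of the line p1 p2 that are joined to u and v. *)
Lemma pencil_points A p1 p2 u v (s : seq (subspace K)) :
    is_arrangement A ->
    is_point p1 -> is_point p2 -> p1 != p2 -> is_point u -> is_point v -> u != v ->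
    ~~ (u <= p1 + p2)%VS -> ~~ (v <= p1 + p2)%VS ->
    (forall p, p \in s -> is_point p /\ (p <= p1 + p2)%VS) ->
    (forall L, L \in A -> [\/ L = (p1 + p2)%VS, L = (u + v)%VS |
       exists2 p, p \in s & L = (p + u)%VS \/ L = (p + v)%VS]) ->
  log_field A (size s).
Proof.
move=> arrA pp1 pp2 p12 up vp uv uM vM sP AP.
have [x xn0 uE] := is_pointP up; have [y yn0 vE] := is_pointP vp.
rewrite -(size_map (fun p => p + u)%VS).
apply: (@log_field_pencil _ charK A (p1 + p2)%VS x y) => //.
- exact: is_line_add.
- by rewrite memvE -uE.
- by rewrite memvE -vE.
- rewrite memvE -vE -uE; apply: contraNN uv => /point_eq -> //.
- move=> a /mapP[p ps ->]; have [pp pM] := sP p ps.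
  rewrite memvE -uE addvSr is_line_add //.
  by apply: contraNneq uM => <-.
move=> L LA; case: (AP L LA) => [->|->|[p ps LE]].
- by constructor 1.
- by constructor 2; rewrite !memvE -uE -vE addvSl addvSr.
have [pp pM] := sP p ps; have [w wn0 pE] := is_pointP pp.
case: LE => ->; first by constructor 3; apply: map_f.
constructor 4; rewrite memvE -vE addvSr; split=> //.
exists (p + u)%VS, w; rewrite !(memvE w) -pE !addvSl; split=> //.
exact: map_f.
Qed.

Lemma quad_log_field p1 p2 p3 p4 :
    is_point p1 -> is_point p2 -> is_point p3 -> is_point p4 -> p1 != p2 -> p3 != p4 ->
    ~~ (p3 <= p1 + p2)%VS -> ~~ (p4 <= p1 + p2)%VS ->
  log_field [fset L in quad_lines p1 p2 p3 p4]%fset 2.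
Proof.
move=> pp1 pp2 pp3 pp4 p12 p34 n3 n4.
have arr : is_arrangement [fset L in quad_lines p1 p2 p3 p4]%fset.
  move=> L; rewrite !inE /= ?orbF; do 5?[case/orP]; move=> /eqP->; apply: is_line_add => //;
    by [apply: contraNneq n3 => <-; rewrite ?addvSl ?addvSr
       |apply: contraNneq n4 => <-; rewrite ?addvSl ?addvSr].
apply: (pencil_points (s := [:: p1; p2]) arr pp1 pp2 p12 pp3 pp4) => //.
  by move=> p; rewrite !inE => /orP[]/eqP->; rewrite ?addvSl ?addvSr.
move=> L; rewrite !inE /= ?orbF; do 5?[case/orP]; move=> /eqP->;
  by [constructor 1|constructor 2|constructor 3; exists p1; rewrite ?inE ?eqxx; auto
     |constructor 3; exists p2; rewrite ?inE ?eqxx ?orbT; auto].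
Qed.

Lemma seven_log_field p1 p2 p3 p4 p5 :
    is_point p1 -> is_point p2 -> is_point p3 -> is_point p4 -> is_point p5 ->
    p1 != p2 -> p4 != p5 -> (p3 <= p1 + p2)%VS ->
    ~~ (p4 <= p1 + p2)%VS -> ~~ (p5 <= p1 + p2)%VS ->
  log_field [fset L in seven_lines p1 p2 p3 p4 p5]%fset 3.
Proof.
move=> pp1 pp2 pp3 pp4 pp5 p12 p45 p3M n4 n5.
have arr : is_arrangement [fset L in seven_lines p1 p2 p3 p4 p5]%fset.
  move=> L; rewrite !inE /= ?orbF; do 6?[case/orP]; move=> /eqP->; apply: is_line_add => //;
    by [apply: contraNneq n4 => <-; rewrite ?addvSl ?addvSr
       |apply: contraNneq n5 => <-; rewrite ?addvSl ?addvSr].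
apply: (pencil_points (s := [:: p1; p2; p3]) arr pp1 pp2 p12 pp4 pp5) => //.
  by move=> p; rewrite !inE ?orbF => /or3P[]/eqP->; rewrite ?addvSl ?addvSr.
move=> L; rewrite !inE /= ?orbF; do 6?[case/orP]; move=> /eqP->;
  by [constructor 1|constructor 2|constructor 3; exists p1; rewrite ?inE ?eqxx; auto
     |constructor 3; exists p2; rewrite ?inE ?eqxx ?orbT; auto
     |constructor 3; exists p3; rewrite ?inE ?eqxx ?orbT; auto].
Qed.

Lemma add_generic_sub_card B C n : add_generic_lines B n C ->
  (B `<=` C)%fset /\ #|` C| = (#|` B| + n)%N.
Proof.
elim=> [|{}n {}C L _ [sBC cC] _ LC _]; first by rewrite addn0.
split; first exact: fsubset_trans sBC (fsubsetUr _ _).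
by rewrite cardfsU1 LC cC; lia.
Qed.

Lemma add_generic_arrangement B C n : add_generic_lines B n C ->
  is_arrangement B -> is_arrangement C.
Proof.
elim=> [//|{}n {}C L _ IH lL _ _ /IH arrC] M /fset1UP[->//|]; exact: arrC.
Qed.

(** When multiplicities are at most 3, a line that passes through no triple
    point meets the others in double points only, so it is generic over the
    rest. *)
Lemma add_generic_of_sub A B : (B `<=` A)%fset -> is_arrangement A -> max_triple A ->
    (forall L p, L \in (A `\` B)%fset -> triple_point A p -> ~~ (p <= L)%VS) ->
  add_generic_lines B #|` (A `\` B)%fset| A.
Proof.
move=> sBA arrA mA nt; move: {2}#|` _| (erefl #|` (A `\` B)%fset|) => n.
elim: n A sBA arrA mA nt => [|n IHn] A sBA arrA mA nt cn.
  rewrite cn; suff <- : A = B by constructor.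
  by apply/eqP; rewrite eqEfsubset sBA andbT -fsetD_eq0 -cardfs_eq0 cn.
have /fset0Pn[L LAB] : (A `\` B)%fset != fset0 by rewrite -cardfs_eq0 cn.
have cn' : #|` ((A `\ L) `\` B)%fset| = n.
  have := cardfsD1 L (A `\` B)%fset; rewrite LAB cn => -[->].
  by congr #|` _|; rewrite !fsetDDl fsetUC.
move: (LAB); rewrite inE => /andP[LB LA].
have sA : (A `\ L `<=` A)%fset := fsubD1set _ _.
rewrite cn -[X in add_generic_lines _ _ X](fsetD1K LA).
apply: AddGenericLine => //.
- rewrite -cn'; apply: IHn => //.
  + by apply/fsubsetP => x xB; rewrite !inE (fsubsetP sBA) // andbT; apply: contraNneq LB => <-.
  + exact: arrangement_sub arrA.
  + exact: max_triple_sub mA.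
  + move=> M p; rewrite !inE => /and3P[MB ML MA] /andP[pp /eqP p3].
    apply: nt; rewrite ?inE ?MB //.
    have := mA p pp; have := multiplicity_sub p sA.
    by rewrite /triple_point /has_multiplicity pp p3 /= => h1 h2; rewrite eqn_leq h2.
- exact: arrA.
- by rewrite !inE eqxx.
- move=> p pp pL; have := mA p pp; have := multiplicityD1 p LA; rewrite pL.
  have := contraL (nt L p LAB) pL; rewrite /triple_point /has_multiplicity pp /=.
  by lia.
Qed.

Lemma fset_six (T : choiceType) (a b c d e f : T) :
  [fset a; b; c; d; e; f]%fset = [fset x in [:: a; b; c; d; e; f]]%fset.
Proof. by apply/fsetP => x; rewrite !inE /= ?orbF -!orbA. Qed.

Lemma A223E : A223 K = [fset L in map (@lineZ K)
  [:: (1, -1, 0); (1, 1, 0); (1, 0, -1); (1, 0, 1); (0, 1, -1); (0, 1, 1)]]%fset.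
Proof.
by rewrite /= !(mulr0z, mulr1z, mulrN1z) -fset_six.
Qed.

Lemma card_fset_seq (T : choiceType) (s : seq T) : uniq s -> #|` [fset x in s]%fset| = size s.
Proof.
by move=> us; rewrite card_fseq undup_id.
Qed.

Lemma mem_fset_seq (T : choiceType) (s : seq T) x : (x \in [fset y in s]%fset) = (x \in s).
Proof. by rewrite !inE. Qed.

Lemma uniq_lineZ (s : seq (int * int * int)) : pairwise independent s -> uniq (map (@lineZ K) s).
Proof.
elim: s => //= t s IHs /andP[ts /IHs ->]; rewrite andbT.
apply/mapP => -[r rs]; apply/eqP/lineZ_neq => //.
by have /allP := ts; apply.
Qed.

Lemma card_A223 : #|` A223 K| = 6%N.
Proof. by rewrite A223E card_fset_seq // uniq_lineZ. Qed.

End Quadrilaterals.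


(** * Projective frames *)

Section Projectivities.

Variable K : fieldType.
Hypothesis charK : [pchar K] =i pred0.

Local Notation V := 'rV[K]_3.
Implicit Types (L M p q : subspace K) (A B C P : {fset subspace K}) (g : 'End(V)).

Lemma imfset_seq (f : subspace K -> subspace K) (s : seq (subspace K)) :
  [fset f L | L in [fset L in s]]%fset = [fset L in map f s]%fset.
Proof.
apply/fsetP => L; apply/imfsetP/idP => /= [[M Ms ->]|].
  by move: Ms; rewrite !inE; apply: map_f.
by rewrite !inE => /mapP[M Ms ->]; exists M; rewrite ?inE.
Qed.

Lemma limg_inj g : lker g == 0%VS -> injective (fun L => (g @: L)%VS).
Proof.
by move=> g0 L M /eqP; rewrite eq_limg_ker0 // => /eqP.
Qed.

Lemma dim_limg g L : lker g == 0%VS -> \dim (g @: L) = \dim L.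
Proof. by move=> /eqP g0; apply: limg_dim_eq; rewrite g0 capv0. Qed.

Lemma multiplicity_limg g A p : lker g == 0%VS ->
  multiplicity [fset (g @: L)%VS | L in A]%fset (g @: p)%VS = multiplicity A p.
Proof.
move=> g0; rewrite /multiplicity.
transitivity #|` [fset (g @: L)%VS | L in [fset L in A | (p <= L)%VS]%fset]%fset|; last first.
  exact: card_imfset (limg_inj g0).
congr #|` _|; apply/fsetP => L; rewrite !inE /=; apply/andP/imfsetP => /=.
  move=> [/imfsetP[M /= MA ->]]; rewrite limg_ker0 // => pM.
  by exists M; rewrite // !inE /= MA.
move=> [M]; rewrite !inE /= => /andP[MA pM] ->; rewrite limg_ker0 // pM.
by rewrite in_imfset.
Qed.

Lemma add_line_vec (x y : V) (a b c : K) : vec a b c != 0 -> x != 0 -> y != 0 ->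
  <[x]>%VS != <[y]>%VS -> x \in line a b c -> y \in line a b c ->
  line a b c = (<[x]> + <[y]>)%VS.
Proof.
by move=> n0 xn0 yn0 xy xL yL; apply: line_through; rewrite ?is_point_line ?is_line_line // -memvE.
Qed.

(** The vectors w1, ..., w4 span the triple points of [A223]; they satisfy
    w1 = w2 + w3 + w4. *)
Definition w1 : V := vec 1 1 1.
Definition w2 : V := vec 1 1 (-1).
Definition w3 : V := vec 1 (-1) 1.
Definition w4 : V := vec (-1) 1 1.

Lemma two_neq0 : (2%:R : K) != 0.
Proof. by rewrite natr_eq0_char0. Qed.

Lemma vline_neq (x y : V) (a b c : K) : x \in line a b c -> y \notin line a b c ->
  <[x]>%VS != <[y]>%VS.
Proof. by move=> xL; apply: contraNneq => xy; rewrite memvE -xy -memvE. Qed.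

Lemma A223_quad :
  A223 K = [fset L in quad_lines <[w1]>%VS <[w2]>%VS <[w3]>%VS <[w4]>%VS]%fset.
Proof.
have N0 : (1 + 1 : K) != 0 by exact: two_neq0.
have N1 : (1 : K) != 0 by exact: oner_neq0.
have N2 : (- 1 - 1 : K) != 0 by rewrite -opprD oppr_eq0.
have w1n : w1 != 0 by rewrite vec_eq0 (negPf N1).
have w2n : w2 != 0 by rewrite vec_eq0 (negPf N1).
have w3n : w3 != 0 by rewrite vec_eq0 (negPf N1).
have w4n : w4 != 0 by rewrite vec_eq0 oppr_eq0 (negPf N1).
have simp := (mem_line_vec, mulr1, mulrN1, mul1r, mul0r, addr0, add0r, subrr,
  @oppr0 K, @opprK K, addNr, eqxx).
have w12 : <[w1]>%VS != <[w2]>%VS by apply: (@vline_neq _ _ 1 0 (-1)); rewrite !simp.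
have w34 : <[w3]>%VS != <[w4]>%VS by apply: (@vline_neq _ _ 1 0 (-1)); rewrite !simp.
have w13 : <[w1]>%VS != <[w3]>%VS by apply: (@vline_neq _ _ 1 (-1) 0); rewrite !simp.
have w24 : <[w2]>%VS != <[w4]>%VS by apply: (@vline_neq _ _ 1 (-1) 0); rewrite !simp.
have w14 : <[w1]>%VS != <[w4]>%VS by apply: (@vline_neq _ _ 1 (-1) 0); rewrite !simp.
have w23 : <[w2]>%VS != <[w3]>%VS by apply: (@vline_neq _ _ 1 (-1) 0); rewrite !simp.
suff -> : quad_lines <[w1]>%VS <[w2]>%VS <[w3]>%VS <[w4]>%VS =
    [:: line 1 (-1) 0; line 1 1 0; line 1 0 (-1); line 1 0 1; line 0 1 (-1); line 0 1 1].
  exact: fset_six.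
have simp0 := (vec_eq0, negPf N1, simp).
by congr [:: _; _; _; _; _; _]; apply/esym/add_line_vec; rewrite // !simp0 ?andbF.
Qed.

Lemma limg_quad g : [fset (g @: L)%VS | L in A223 K]%fset =
  [fset L in quad_lines <[g w1]>%VS <[g w2]>%VS <[g w3]>%VS <[g w4]>%VS]%fset.
Proof. by rewrite A223_quad imfset_seq /quad_lines /= !limgD !limg_line. Qed.

Lemma A223_log_field g : lker g == 0%VS ->
  log_field [fset (g @: L)%VS | L in A223 K]%fset 2.
Proof.
move=> g0; rewrite limg_quad.
have N0 : (1 + 1 : K) != 0 by exact: two_neq0.
have N1 : (1 : K) != 0 by exact: oner_neq0.
have N2 : (- 1 - 1 : K) != 0 by rewrite -opprD oppr_eq0.
have simp := (mem_line_vec, mulr1, mulrN1, mul1r, mul0r, addr0, add0r, subrr,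
  @oppr0 K, @opprK K, addNr, eqxx).
have simp0 := (vec_eq0, oppr_eq0, negPf N1, simp).
have w12 : <[w1]>%VS != <[w2]>%VS by apply: (@vline_neq _ _ 1 0 (-1)); rewrite !simp.
have w34 : <[w3]>%VS != <[w4]>%VS by apply: (@vline_neq _ _ 1 0 (-1)); rewrite !simp.
have pg (w : V) : w != 0 -> is_point <[g w]>%VS.
  by rewrite -limg_line /is_point dim_limg // dim_vline => ->.
have M12 : (<[w1]> + <[w2]>)%VS = line 1 (-1) 0.
  by apply/esym/add_line_vec; rewrite // !simp0.
apply: quad_log_field; rewrite -?limg_line -?limgD ?eq_limg_ker0 ?limg_ker0 //;
  rewrite ?limg_line ?pg ?simp0 ?M12 -?memvE ?simp //.
Qed.

Lemma from_A223_log_field A n : is_arrangement A -> from_A223 A n ->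
  log_field A (2 + n) /\ #|` A| = (6 + n)%N.
Proof.
move=> arrA [C Cgen [g g0 AE]].
have [sC cC] := add_generic_sub_card Cgen.
have cA : #|` A| = #|` C| by rewrite AE; apply: card_imfset (limg_inj g0).
have cA0 : #|` [fset (g @: L)%VS | L in A223 K]%fset| = 6%N.
  by rewrite -[RHS](card_A223 charK); apply: card_imfset (limg_inj g0).
have sA : ([fset (g @: L)%VS | L in A223 K] `<=` A)%fset.
  apply/fsubsetP => L /imfsetP[M /= MA ->]; rewrite AE.
  by apply/imfsetP; exists M; rewrite ?(fsubsetP sC).
have := log_field_extend charK sA arrA (A223_log_field g0).
by rewrite cardfsDS // cA0 cA cC (card_A223 charK) addKn.
Qed.

(** Scale spanning vectors v2, v3, v4 of the last three points so that v2 +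
    v3 + v4 spans p1. The unit vectors are (w2 + w3) / 2, (w2 + w4) / 2 and
    (w3 + w4) / 2, so the matrix with rows v2 + v3, v2 + v4 and v3 + v4 maps
    each w_i to twice v_i. *)
Lemma exists_frame p1 p2 p3 p4 :
    is_point p1 -> is_point p2 -> is_point p3 -> is_point p4 ->
    p2 != p3 -> ~~ (p4 <= p2 + p3)%VS -> ~~ (p1 <= p2 + p3)%VS ->
    ~~ (p1 <= p2 + p4)%VS -> ~~ (p1 <= p3 + p4)%VS ->
  exists g : 'End(V), [/\ lker g == 0%VS, <[g w1]>%VS = p1, <[g w2]>%VS = p2,
    <[g w3]>%VS = p3 & <[g w4]>%VS = p4].
Proof.
move=> pp1 pp2 pp3 pp4 p23 n4 n23 n24 n34.
have [x1 x1n0 p1E] := is_pointP pp1; have [x2 x2n0 p2E] := is_pointP pp2.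
have [x3 x3n0 p3E] := is_pointP pp3; have [x4 x4n0 p4E] := is_pointP pp4.
have lL : is_line (p2 + p3)%VS by exact: is_line_add.
have full : (p2 + p3 + p4)%VS = fullv.
  apply/eqP; rewrite eqEdim subvf dim_space dimv_disjoint_sum ?(eqP lL) ?(eqP pp4) //.
  apply/eqP; apply: contraNT n4 => c0.
  have cp : is_point ((p2 + p3) :&: p4)%VS.
    rewrite /is_point eqn_leq lt0n dimv_eq0 c0 andbT.
    by rewrite -[leqRHS](eqP pp4) dimvS ?capvSr.
  by rewrite -(point_eq cp pp4 (capvSr _ _)) capvSl.
have : x1 \in (p2 + p3 + p4)%VS by rewrite full memvf.
rewrite p2E p3E p4E.
move=> /memv_addP[_ /memv_addP[_ /vlineP[a ->] [_ /vlineP[b ->] ->]] [_ /vlineP[c ->] x1E]].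
have cn0 : c != 0.
  apply: contraNneq n23 => c0; rewrite p1E p2E p3E -memvE x1E c0 scale0r addr0.
  by rewrite memv_add ?memvZ ?memv_line.
have bn0 : b != 0.
  apply: contraNneq n24 => b0; rewrite p1E p2E p4E -memvE x1E b0 scale0r addr0.
  by rewrite memv_add ?memvZ ?memv_line.
have an0 : a != 0.
  apply: contraNneq n34 => a0; rewrite p1E p3E p4E -memvE x1E a0 scale0r add0r.
  by rewrite memv_add ?memvZ ?memv_line.
pose v2 := a *: x2; pose v3 := b *: x3; pose v4 := c *: x4.
pose G : 'M[K]_3 := \matrix_(i, j) ([:: v2 + v3; v2 + v4; v3 + v4]`_i) ord0 j.
pose g : 'End(V) := linfun (mulmxr G).
have gE x y z : g (vec x y z) = (x + y) *: v2 + (x + z) *: v3 + (y + z) *: v4.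
  rewrite lfunE /= mulmx_sum_row !big_ord_recl big_ord0 !mxE /= addr0.
  have rowE i : row i G = [:: v2 + v3; v2 + v4; v3 + v4]`_i.
    by apply/rowP => j; rewrite !mxE.
  by rewrite !rowE /=; apply/rowP => j; rewrite !mxE; ring.
have two : (2%:R : K) != 0 := two_neq0.
have vline_scale (k : K) (x : V) : k != 0 -> <[k *: x]>%VS = <[x]>%VS.
  move=> kn0; have [->|xn0] := eqVneq x 0; first by rewrite scaler0.
  apply: point_eq; rewrite ?is_point_line ?scaler_eq0 ?negb_or ?kn0 //.
  by rewrite -memvE memvZ ?memv_line.
have gw2 : g w2 = (2%:R * a) *: x2.
  by rewrite gE /v2 subrr !scale0r !addr0 scalerA.
have gw3 : g w3 = (2%:R * b) *: x3.
  by rewrite gE /v3 subrr addNr !scale0r add0r addr0 scalerA.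
have gw4 : g w4 = (2%:R * c) *: x4.
  by rewrite gE /v4 !addNr !scale0r !add0r scalerA.
have gw1 : g w1 = 2%:R *: x1.
  by rewrite gE x1E /v2 /v3 /v4 !scalerDr !scalerA.
exists g; rewrite gw1 gw2 gw3 gw4; split; rewrite ?vline_scale ?mulf_neq0 //.
rewrite -subv0; apply/subvP => u; rewrite memv_ker memv0.
have [x [y [z ->]]] := vecP u; rewrite gE => /eqP g0.
have hN (k l m : K) : k *: v2 + l *: v3 + m *: v4 = 0 -> [/\ k = 0, l = 0 & m = 0].
  have p2v : p2 = <[v2]>%VS by rewrite p2E vline_scale.
  have p3v : p3 = <[v3]>%VS by rewrite p3E vline_scale.
  have p4v : p4 = <[v4]>%VS by rewrite p4E vline_scale.
  have m0 : k *: v2 + l *: v3 + m *: v4 = 0 -> m = 0.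
    move=> /eqP; rewrite addrC addr_eq0 => /eqP mE; apply/eqP; apply: contraNT n4 => mn0.
    rewrite p4v -memvE -[v4]scale1r -(mulVf mn0) -scalerA mE memvZ // memvN.
    by rewrite p2v p3v; apply: memv_add; apply: memvZ; apply: memv_line.
  move=> klm; have := klm; rewrite (m0 klm) scale0r addr0 => kl.
  have l0 : l = 0.
    apply/eqP; apply: contraNT p23 => ln0; apply/eqP/esym/point_eq => //.
    rewrite p3v p2v -memvE -[v3]scale1r -(mulVf ln0) -scalerA memvZ //.
    move/eqP: kl; rewrite addrC addr_eq0 => /eqP ->.
    by rewrite memvN; apply: memvZ; apply: memv_line.
  split=> //; move: kl; rewrite l0 scale0r addr0 => /eqP; rewrite scaler_eq0 => /orP[/eqP //|v20].
  by rewrite /is_point p2v (eqP v20) dim_vline eqxx in pp2.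
have [e1 e2 e3] := hN _ _ _ g0.
have half (t : K) : 2%:R * t = 0 -> t == 0.
  by move/eqP; rewrite mulf_eq0 (negPf two).
rewrite vec_eq0; apply/and3P; split; apply: half.
- by rewrite (_ : _ * _ = (x + y) + (x + z) - (y + z)); [rewrite e1 e2 e3 subr0 addr0 | ring].
- by rewrite (_ : _ * _ = (x + y) + (y + z) - (x + z)); [rewrite e1 e2 e3 subr0 addr0 | ring].
- by rewrite (_ : _ * _ = (x + z) + (y + z) - (x + y)); [rewrite e1 e2 e3 subr0 addr0 | ring].
Qed.

End Projectivities.


(** * Four triple points, and lines rich in triple points *)

Section FewTriplePoints.

Variable K : fieldType.
Hypothesis charK : [pchar K] =i pred0.

Local Notation V := 'rV[K]_3.
Implicit Types (L M p q : subspace K) (A B C P : {fset subspace K}) (g : 'End(V)).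

(** The hypothesis [lines_have_extra_triple_point] in terms of the set of
    triple points. *)
Definition extra A P := forall p L, p \in P -> L \in A -> (p <= L)%VS ->
  exists q, [/\ q \in P, q != p & (q <= L)%VS].

Lemma triple_is_point A P p : triple_points A P -> p \in P -> is_point p.
Proof. by move=> PA; rewrite PA => /andP[]. Qed.

(** The three lines through p contain another triple point each, and there
    are just three others. So each of these lies on one line through p, and
    no two lie on the same one. *)
Lemma four_joined A P : is_arrangement A -> triple_points A P -> extra A P ->
    #|` P| = 4%N ->
  (forall p q, p \in P -> q \in P -> p != q -> (p + q)%VS \in A) /\
  (forall p q r, p \in P -> q \in P -> r \in P -> p != q -> p != r -> q != r ->
     ~~ (r <= p + q)%VS).
Proof.
move=> arrA PA ex P4.
have main p : p \in P ->
  [fset L in A | (p <= L)%VS]%fset = [fset (p + q)%VS | q in (P `\ p)%fset]%fset /\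
  #|` [fset (p + q)%VS | q in (P `\ p)%fset]%fset| = #|` (P `\ p)%fset|.
  move=> pP; have sub := extra_lines arrA PA pP (fun L => ex p L pP).
  have c3 : #|` [fset L in A | (p <= L)%VS]%fset| = 3%N by apply: triple_lines_card; rewrite -PA.
  have cP : #|` (P `\ p)%fset| = 3%N by have := cardfsD1 p P; rewrite pP P4; lia.
  have cim : (#|` [fset (p + q)%VS | q in (P `\ p)]%fset| <= #|` (P `\ p)%fset|)%N.
    exact: leq_imfset_card.
  have E : [fset L in A | (p <= L)%VS]%fset = [fset (p + q)%VS | q in (P `\ p)%fset]%fset.
    by apply/eqP; rewrite eqEfcard sub /= (leq_trans cim) // cP c3.
  by split; rewrite // -E c3 cP.
split=> [p q pP qP pq|p q r pP qP rP pq pr qr].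
  have [E _] := main p pP.
  have : (p + q)%VS \in [fset L in A | (p <= L)%VS]%fset.
    by rewrite E; apply/imfsetP; exists q; rewrite //= !inE eq_sym pq.
  by rewrite !inE => /andP[].
have [_ /eqP/card_in_imfsetP inj] := main p pP.
have [pp pq' pr'] := And3 (triple_is_point PA pP) (triple_is_point PA qP) (triple_is_point PA rP).
apply: contraNN qr => rL; apply/eqP; apply: inj; rewrite ?inE 1?eq_sym ?pq ?pr //.
by apply: line_through; rewrite ?is_line_add ?addvSl.
Qed.

Lemma fset_enum (T : choiceType) (P : {fset T}) n : #|` P| = n ->
  exists s : seq T, [/\ uniq s, size s = n & P =i s].
Proof. by move=> cP; exists (enum_fset P). Qed.

(** The six lines that join the four points are a projective image of
    [A223]. Every line through a triple point is one of them, so the others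
    are generic. *)
Lemma four_points A P : is_arrangement A -> max_triple A -> triple_points A P ->
    extra A P -> #|` P| = 4%N ->
  [/\ from_A223 A (#|` A| - 6), log_field A (#|` A| - 4)
    & exists2 L, L \in A & #|` [fset q in P | (q <= L)%VS]%fset| = 2%N].
Proof.
move=> arrA mA PA ex P4; have [joined noncol] := four_joined arrA PA ex P4.
have [s [us ss sE]] := fset_enum P4.
case: s us ss sE => [|p1 [|p2 [|p3 [|p4 [|]]]]] //= us _ sE.
have [P1 P2 P3 P4'] : [/\ p1 \in P, p2 \in P, p3 \in P & p4 \in P].
  by rewrite !sE !inE !eqxx ?orbT.
move: us; rewrite !inE !negb_or -!andbA => /and5P[p12 p13 p14 p23 /and3P[p24 p34 _]].
have pp p : p \in P -> is_point p by apply: triple_is_point PA.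
have [g [g0 g1 g2 g3 g4]] : exists g : 'End(V), [/\ lker g == 0%VS, <[g (w1 K)]>%VS = p1,
    <[g (w2 K)]>%VS = p2, <[g (w3 K)]>%VS = p3 & <[g (w4 K)]>%VS = p4].
  by apply: exists_frame => //; try exact: pp; apply: noncol => //; rewrite eq_sym.
have B0E := limg_quad charK g; rewrite g1 g2 g3 g4 in B0E.
set B0 := [fset L in _]%fset in B0E.
have B0A : (B0 `<=` A)%fset.
  apply/fsubsetP => L; rewrite mem_fset_seq !inE; do 5?[case/orP];
    by move=> /eqP ->; apply: joined.
have ginj := limg_inj g0.
have gVg (L : subspace K) : (g @: (g^-1%VF @: L))%VS = L.
  by rewrite -limg_comp lker0_compfV ?lim1g.
(* The arrangement in the coordinates where the quadrilateral is A223. *)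
pose C := [fset (g^-1%VF @: L)%VS | L in A]%fset.
have AE : A = [fset (g @: L)%VS | L in C]%fset.
  apply/fsetP => L; apply/idP/imfsetP => [LA|[M /= /imfsetP[N /= NA ->] ->]]; last by rewrite gVg.
  by exists (g^-1%VF @: L)%VS; rewrite ?gVg // in_imfset.
have cA : #|` A| = #|` C| by rewrite {1}AE; apply: card_imfset ginj.
have inC L : ((g @: L)%VS \in A) = (L \in C) by rewrite AE mem_imfset.
have inB0 L : ((g @: L)%VS \in B0) = (L \in A223 K) by rewrite -B0E mem_imfset.
have sC : (A223 K `<=` C)%fset.
  by apply/fsubsetP => L; rewrite -inB0 -inC => /(fsubsetP B0A).
have cB0 : #|` B0| = 6%N.
  by rewrite -B0E -[RHS](card_A223 charK); apply: card_imfset ginj.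
have point_g p : is_point (g @: p)%VS = is_point p by rewrite /is_point dim_limg.
have mult_g p : multiplicity A (g @: p)%VS = multiplicity C p by rewrite {1}AE multiplicity_limg.
split.
- exists C; last by exists g.
  rewrite cA -(card_A223 charK) -(cardfsDS sC); apply: add_generic_of_sub => //.
  + by move=> L; rewrite -inC => /arrA; rewrite /is_line dim_limg.
  + by move=> p; rewrite -point_g -mult_g; apply: mA.
  move=> L p; rewrite in_fsetD => /andP[LB LC] /andP[pp' mp].
  have gpP : (g @: p)%VS \in P by rewrite PA /triple_point /has_multiplicity point_g pp' mult_g.
  apply: contra LB => pL; rewrite -inB0.
  have gL : (g @: p <= g @: L)%VS by rewrite limg_ker0.
  have gLA : (g @: L)%VS \in A by rewrite inC.
  have [q [qP qp qL]] := ex _ _ gpP gLA gL.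
  rewrite (@line_through _ (g @: p)%VS q (g @: L)%VS) ?point_g //; first last.
  - exact: arrA.
  - by rewrite eq_sym.
  - exact: pp.
  move: qP gpP qp; rewrite !sE !inE.
  by case/or4P => /eqP ->; case/or4P => /eqP ->; rewrite ?eqxx //= => _;
     rewrite ?eqxx ?orbT // addvC eqxx ?orbT.
- have B2 : log_field B0 2 by rewrite -B0E; apply: A223_log_field.
  have := log_field_extend charK B0A arrA B2; rewrite cardfsDS // cB0.
  have cA6 : (6 <= #|` A|)%N by rewrite -cB0 fsubset_leq_card.
  have -> : (2 + (#|` A| - 6) = #|` A| - 4)%N by clear -cA6; lia.
  exact.
- exists (p1 + p2)%VS; first exact: joined.
  rewrite -[RHS]/(size [:: p1; p2]) -(@card_fset_seq _ [:: p1; p2]) /=; last by rewrite !inE p12.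
  congr #|` _|; apply/fsetP => q; rewrite !inE /= ?orbF; apply/andP/orP.
    move=> [qP qL]; have [_|q1] := eqVneq q p1; first by left.
    have [_|q2] := eqVneq q p2; first by right.
    by have := noncol p1 p2 q P1 P2 qP p12; rewrite ![_ == q]eq_sym q1 q2 qL => /(_ isT isT).
  by case=> /eqP ->; rewrite ?addvSl ?addvSr.
Qed.

(** Count incidences between lines and triple points: there are 3 |P|, an
    odd number, so some line has an odd number of triple points, which is
    not 1 by hypothesis. *)
Lemma exists_rich_line A P : triple_points A P -> extra A P -> odd #|` P| ->
  exists2 M, M \in A & (3 <= #|` [fset p in P | (p <= M)%VS]%fset|)%N.
Proof.
move=> PA ex P_odd; apply: NNPP => none.
have t02 L : L \in A -> odd #|` [fset p in P | (p <= L)%VS]%fset| = false.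
  move=> LA; set t := [fset p in P | _]%fset.
  have t3 : (#|` t| < 3)%N by rewrite ltnNge; apply/negP => t3; apply: none; exists L.
  suff t1 : #|` t| != 1%N by clear -t3 t1; case: #|` t| t3 t1 => [|[|[|]]].
  apply/negP => /cardfs1P[p tE].
  have : p \in t by rewrite tE inE.
  rewrite !inE /= => /andP[pP pL]; have [q [qP qp qL]] := ex p L pP LA pL.
  have : q \in t by rewrite !inE /= qP.
  by rewrite tE inE (negPf qp).
have sum3 : (\sum_(L <- A) #|` [fset p in P | (p <= L)%VS]%fset| = 3 * #|` P|)%N.
  transitivity (\sum_(L <- A) \sum_(p <- P | (p <= L)%VS) 1)%N.
    by apply: eq_bigr => L _; rewrite card_fset_filter sum1_count.
  rewrite (exchange_big_dep predT) //= mulnC -[in RHS]sum1_size big_distrl /=.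
  rewrite big_seq [RHS]big_seq; apply: eq_bigr => p; rewrite PA => /triple_lines_card.
  by rewrite card_fset_filter sum1_count mul1n.
have : odd (\sum_(L <- A) #|` [fset p in P | (p <= L)%VS]%fset|) = false.
  rewrite big_seq; apply: (big_ind (fun n => odd n = false)) => // m n.
  by rewrite oddD => -> ->.
by rewrite sum3 oddM P_odd.
Qed.

(** Two lines through p are different from M. Each contains another triple
    point, which is not on M, so one of them contains q and the other one r. *)
Lemma rich_line_joined A P p q r M : is_arrangement A -> triple_points A P -> extra A P ->
    M \in A -> p \in P -> (p <= M)%VS ->
    (forall x, x \in P -> x != p -> [\/ (x <= M)%VS, x = q | x = r]) ->
  [/\ (p + q)%VS \in A, (p + r)%VS \in A, (p + q)%VS != (p + r)%VS,
      (p + q)%VS != M & (p + r)%VS != M].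
Proof.
move=> arrA PA ex MA pP pM split3.
have pp := triple_is_point PA pP.
set T := ([fset L in A | (p <= L)%VS] `\ M)%fset.
have T2 : #|` T| = 2%N.
  have c3 : #|` [fset L in A | (p <= L)%VS]%fset| = 3%N by apply: triple_lines_card; rewrite -PA.
  have := cardfsD1 M [fset L in A | (p <= L)%VS]%fset; rewrite c3 !inE /= MA pM /= -/T.
  by clear; lia.
have sT : (T `<=` [fset (p + q)%VS; (p + r)%VS])%fset.
  apply/fsubsetP => L; rewrite in_fsetD1 => /andP[LM Lls].
  have /imfsetP[x /=] := fsubsetP (extra_lines arrA PA pP (fun L => ex p L pP)) L Lls.
  rewrite !inE => /andP[xp xP] LE; rewrite LE.
  case: (split3 x xP xp) => [xM|->|->]; rewrite ?eqxx ?orbT //.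
  case/eqP: LM; rewrite LE; apply/esym/line_through => //; last exact: arrA.
    exact: triple_is_point PA xP.
  by rewrite eq_sym.
have c2 : #|` [fset (p + q)%VS; (p + r)%VS]%fset| = ((p + q)%VS != (p + r)%VS).+1.
  exact: cardfs2.
have TE : T = [fset (p + q)%VS; (p + r)%VS]%fset.
  by apply/eqP; rewrite eqEfcard sT c2 T2; case: (_ != _).
have qr : (p + q)%VS != (p + r)%VS.
  by move: T2; rewrite TE c2; case: (_ != _).
have : (p + q)%VS \in T by rewrite TE !inE eqxx.
have : (p + r)%VS \in T by rewrite TE !inE eqxx orbT.
by rewrite !inE => /and3P[-> -> _] /and3P[-> -> _].
Qed.

End FewTriplePoints.


(** * Intersection lattices *)

Section Lattices.

Variable K : fieldType.

Local Notation V := 'rV[K]_3.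
Implicit Types (L M p q X Y : subspace K) (A B C : {fset subspace K}).

Definition cap (s : seq (subspace K)) : subspace K := (\bigcap_(L <- s) L)%VS.

Lemma sub_cap X (s : seq (subspace K)) : (X <= cap s)%VS = all (fun L => X <= L)%VS s.
Proof.
rewrite /cap; elim: s => [|L s IHs]; first by rewrite big_nil subvf.
by rewrite big_cons subv_cap IHs.
Qed.

Lemma cap_sub (s : seq (subspace K)) L : L \in s -> (cap s <= L)%VS.
Proof. by move=> Ls; have := subvv (cap s); rewrite sub_cap => /allP; apply. Qed.

(** A combinatorial form of the statement that the intersection of the lines
    of B lies on L: either L is in B, or two lines of B meet on L, or the
    intersection is zero because three lines of B are not concurrent. *)
Definition cap_witness B L := L \in B \/ exists L1 L2,
  [/\ L1 \in B, L2 \in B, L1 != L2, L != L1 & L != L2] /\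
  (concurrent L1 L2 L \/
   exists L3, [/\ L3 \in B, L3 != L1, L3 != L2 & ~~ concurrent L1 L2 L3]).

Lemma concurrent_sub L1 L2 L3 : is_line L1 -> is_line L2 -> L1 != L2 ->
  concurrent L1 L2 L3 = (L1 :&: L2 <= L3)%VS.
Proof.
move=> l1 l2 l12; have pp := line_cap l1 l2 l12.
rewrite /concurrent; apply/idP/idP => [c|/capv_idPl ->]; last first.
  by rewrite -dimv_eq0 (eqP pp).
have cp : is_point (L1 :&: L2 :&: L3)%VS.
  rewrite /is_point eqn_leq lt0n dimv_eq0 c andbT.
  by rewrite -[leqRHS](eqP pp) dimvS ?capvSl.
by rewrite -(point_eq cp pp (capvSl _ _)) capvSr.
Qed.

Lemma cap_subP A B L : is_arrangement A -> (B `<=` A)%fset -> L \in A ->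
  (cap (enum_fset B) <= L)%VS <-> cap_witness B L.
Proof.
move=> arrA /fsubsetP sBA LA; split; last first.
  case=> [LB|[L1 [L2 [[L1B L2B L12 _ _] c]]]]; first exact: cap_sub.
  have le12 : (cap (enum_fset B) <= L1 :&: L2)%VS by rewrite subv_cap !cap_sub.
  case: c => [|[L3 [L3B _ _ c3]]].
    by rewrite concurrent_sub ?arrA ?sBA // => /(subv_trans le12).
  have : (cap (enum_fset B) <= L1 :&: L2 :&: L3)%VS by rewrite subv_cap le12 cap_sub.
  by move: c3; rewrite negbK => /eqP ->; rewrite subv0 => /eqP ->; rewrite sub0v.
move=> capL; have [LB|LB] := boolP (L \in B); [by left | right].
have [L1 L1B] : exists L1, L1 \in B.
  apply/fset0Pn; apply: contraTneq capL => ->; rewrite /cap big_nil.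
  by have [e eL] := notin_line (arrA L LA); apply: contra eL => /subvP->; rewrite ?memvf.
have LL1 : L != L1 by apply: contraNneq LB => ->.
have [L2 L2B L12] : exists2 L2, L2 \in B & L1 != L2.
  have [/allP all1|/allPn[L2 L2B]] := boolP (all (pred1 L1) (enum_fset B)); last first.
    by rewrite /= eq_sym; exists L2.
  have L1cap : (L1 <= cap (enum_fset B))%VS.
    by rewrite sub_cap; apply/allP => M /all1/eqP ->.
  have := subv_trans L1cap capL.
  rewrite eq_sym in LL1.
  by rewrite (negPf (line_notsub (arrA _ (sBA _ L1B)) (arrA _ LA) LL1)).
have [l1 l2] : is_line L1 /\ is_line L2 by split; apply: arrA; apply: sBA.
have LL2 : L != L2 by apply: contraNneq LB => ->.
exists L1, L2; split; first by split.
have [all12|/allPn[L3 L3B c3]] := boolP (all (fun M => L1 :&: L2 <= M)%VS (enum_fset B)).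
  by left; rewrite concurrent_sub // (subv_trans _ capL) // sub_cap.
right; exists L3; split; rewrite ?concurrent_sub //.
  by apply: contraNneq c3 => ->; apply: capvSl.
by apply: contraNneq c3 => ->; apply: capvSr.
Qed.

(** By [cap_subP] a bijection of the lines that respects concurrence
    respects the relation that an intersection lies on a line. The map of
    lattices sends X to the intersection of the images of the lines through
    X. *)
Lemma lattice_of_concurrences A C (sigma : subspace K -> subspace K) :
    is_arrangement A -> is_arrangement C -> {in A &, injective sigma} ->
    (forall M, (M \in C) <-> exists2 L, L \in A & M = sigma L) ->
    (forall L1 L2 L3, L1 \in A -> L2 \in A -> L3 \in A -> L1 != L2 -> L3 != L1 -> L3 != L2 ->
       concurrent (sigma L1) (sigma L2) (sigma L3) = concurrent L1 L2 L3) ->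
  same_intersection_lattice A C.
Proof.
move=> arrA arrC inj onto conc.
pose img B := [fset sigma L | L in B]%fset.
have sigmaC L : L \in A -> sigma L \in C by move=> LA; apply/onto; exists L.
have imgC B : (B `<=` A)%fset -> (img B `<=` C)%fset.
  move=> sBA; apply/fsubsetP => M /imfsetP[L /= LB ->].
  by apply: sigmaC; apply: (fsubsetP sBA).
have inj_neq L M : L \in A -> M \in A -> (sigma L != sigma M) = (L != M).
  move=> LA MA; congr negb; apply/eqP/eqP => [|->//]; exact: inj.
have mem_img B L : (B `<=` A)%fset -> L \in A -> (sigma L \in img B) = (L \in B).
  move=> sBA LA; apply/imfsetP/idP => /= [[M MB /inj ->]|LB] //; last by exists L.
  exact: (fsubsetP sBA).
have cap_img B L : (B `<=` A)%fset -> L \in A ->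
    (cap (enum_fset (img B)) <= sigma L)%VS = (cap (enum_fset B) <= L)%VS.
  move=> sBA LA; have BA M : M \in B -> M \in A by move=> MB; apply: (fsubsetP sBA).
  apply/idP/idP.
    move/(cap_subP arrC (imgC B sBA) (sigmaC L LA)) => w; apply/(cap_subP arrA sBA LA).
    case: w => [|[M1 [M2 [[/imfsetP[L1 /= L1B ->] /imfsetP[L2 /= L2B ->]]]]]].
      by rewrite mem_img //; left.
    rewrite !inj_neq ?LA ?BA // => L12 LL1 LL2 c; right; exists L1, L2; split; first by split.
    case: c => [|[M3 [/imfsetP[L3 /= L3B ->]]]]; first by rewrite conc ?LA ?BA //; left.
    rewrite !inj_neq ?LA ?BA // => L31 L32; rewrite conc ?LA ?BA // => c; right.
    by exists L3; split.
  move/(cap_subP arrA sBA LA) => w; apply/(cap_subP arrC (imgC B sBA) (sigmaC L LA)).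
  case: w => [LB|[L1 [L2 [[L1B L2B L12 LL1 LL2] c]]]]; first by left; rewrite mem_img.
  right; exists (sigma L1), (sigma L2); rewrite !mem_img ?inj_neq ?LA ?BA //; split=> //.
  case: c => [c|[L3 [L3B L31 L32 c]]]; first by left; rewrite conc ?LA ?BA.
  right; exists (sigma L3); rewrite mem_img ?inj_neq ?LA ?BA //; split=> //.
  by rewrite conc ?LA ?BA.
pose phi X := cap [seq sigma L | L <- enum_fset A & (X <= L)%VS].
have phiE B : (B `<=` A)%fset -> phi (cap (enum_fset B)) = cap (enum_fset (img B)).
  move=> sBA; apply/eqP; rewrite eqEsubv; apply/andP; split.
    rewrite sub_cap; apply/allP => M /imfsetP[L /= LB ->].
    by apply: cap_sub; apply: map_f; rewrite mem_filter cap_sub //= (fsubsetP sBA).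
  rewrite sub_cap; apply/allP => M /mapP[L]; rewrite mem_filter => /andP[BL LA] ->.
  by rewrite cap_img.
have inter_cap D X : X \in intersections D <-> exists2 B, (B `<=` D)%fset & X = cap (enum_fset B).
  split=> [/imfsetP[B /=]|[B sBD ->]]; first by rewrite fpowersetE => sBD ->; exists B.
  by apply/imfsetP; exists B; rewrite //= fpowersetE.
exists phi => [X Y /inter_cap[B sB ->] /inter_cap[B' sB' ->]|].
  rewrite !phiE // [RHS]sub_cap [LHS]sub_cap; apply/allP/allP => H L LB.
    have LA := fsubsetP sB' L LB.
    by rewrite -cap_img // H // mem_img.
  have /imfsetP[M /= MB' ->] := LB; rewrite cap_img ?H //; exact: (fsubsetP sB').
apply/fsetP => X; apply/idP/imfsetP => /= [/inter_cap[D sDC ->]|[Y /inter_cap[B sBA ->] ->]].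
  pose B := [fset L in A | sigma L \in D]%fset.
  have sBA : (B `<=` A)%fset by apply/fsubsetP => L; rewrite !inE /= => /andP[].
  exists (cap (enum_fset B)); first by apply/inter_cap; exists B.
  rewrite phiE //; congr (cap (enum_fset _)); apply/fsetP => M.
  apply/idP/imfsetP => /= [MD|[L]]; last by rewrite !inE /= => /andP[_ LD] ->.
  have /onto[L LA ME] : M \in C by apply: (fsubsetP sDC).
  by exists L; rewrite // !inE /= LA -ME.
by apply/inter_cap; exists (img B); rewrite ?phiE //; apply: imgC.
Qed.

End Lattices.


(** * Seven lines in five pencils of three *)

Section FivePencils.

Variable K : fieldType.
Hypothesis charK : [pchar K] =i pred0.

Local Notation V := 'rV[K]_3.
Implicit Types (L M p q X Y : subspace K) (A B C P : {fset subspace K}) (s : seq (subspace K)).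

(** The concurrent triples among [seven_lines], by position in that list:
    the pencils at p1, ..., p5. *)
Definition five_pencils : seq (seq nat) :=
  [:: [:: 0; 1; 4]; [:: 0; 2; 5]; [:: 0; 3; 6]; [:: 1; 2; 3]; [:: 4; 5; 6]]%N.

Definition in_common_pencil (i j k : nat) :=
  has (fun r => [&& i \in r, j \in r & k \in r]) five_pencils.

Local Notation line_at s i := (nth (0%VS : subspace K) s i).

(** The sequence s lists the lines of A so that the only concurrences are
    the five pencils among the first seven lines. *)
Definition labelled A s := [/\ uniq s, s =i A, (7 <= size s)%N &
  forall i j k, (i < size s)%N -> (j < size s)%N -> (k < size s)%N ->
    i != j -> k != i -> k != j ->
  concurrent (line_at s i) (line_at s j) (line_at s k) = in_common_pencil i j k].

Lemma labelled_lattice A C s t : is_arrangement A -> is_arrangement C ->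
  labelled A s -> labelled C t -> size s = size t -> same_intersection_lattice A C.
Proof.
move=> arrA arrC [us sA _ sP] [ut tC _ tP] st.
have idx L : L \in A -> (index L s < size s)%N by rewrite -sA index_mem.
have idx_neq L L' : L \in A -> L' \in A -> L != L' -> index L s != index L' s.
  move=> LA L'A; apply: contraNneq => e; apply/eqP.
  by rewrite -(nth_index 0%VS (_ : L \in s)) ?sA // e nth_index // sA.
apply: (@lattice_of_concurrences _ _ _ (fun L => line_at t (index L s))) => //.
- move=> L L' LA L'A /eqP; rewrite nth_uniq -?st ?idx // => /eqP e.
  by rewrite -(nth_index 0%VS (_ : L \in s)) ?sA // e nth_index // sA.
- move=> M; rewrite -tC; split=> [Mt|[L LA ->]]; last by rewrite mem_nth // -st idx.
  have it : (index M t < size s)%N by rewrite st index_mem.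
  exists (line_at s (index M t)); first by rewrite -sA mem_nth.
  by rewrite index_uniq // nth_index.
- move=> L1 L2 L3 L1A L2A L3A L12 L31 L32.
  rewrite tP -?st ?idx ?idx_neq // -sP ?idx ?idx_neq //.
  by rewrite !nth_index ?sA.
Qed.

Lemma multiplicity_two_lines C L1 L2 p : L1 \in C -> L2 \in C -> L1 != L2 ->
  (p <= L1)%VS -> (p <= L2)%VS -> (2 <= multiplicity C p)%N.
Proof.
move=> L1C L2C L12 p1 p2.
have -> : 2%N = #|` [fset L1; L2]%fset| by rewrite cardfs2 L12.
apply/fsubset_leq_card/fsubsetP => L /fset2P[] ->; rewrite !inE /=.
  by rewrite L1C.
by rewrite L2C.
Qed.

Lemma in_common_pencil_lt i j k : in_common_pencil i j k -> [/\ (i < 7)%N, (j < 7)%N & (k < 7)%N].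
Proof.
case/hasP => r r5 /and3P[ir jr kr].
have lt7 x : x \in r -> (x < 7)%N.
  have /allP/(_ r r5)/allP : all (all (fun x => x < 7)%N) five_pencils by [].
  exact.
by split; apply: lt7.
Qed.

(** A generic line is concurrent with no two lines of C, and its position is
    beyond the first seven. *)
Lemma labelled_generic C s L : labelled C s -> is_line L -> L \notin C ->
    (forall p, is_point p -> (p <= L)%VS -> (multiplicity C p <= 1)%N) ->
  labelled (L |` C)%fset (rcons s L).
Proof.
move=> [us sC s7 sP] lL LC gen; split.
- by rewrite rcons_uniq sC LC.
- by move=> M; rewrite mem_rcons !inE sC.
- by rewrite size_rcons ltnW.
have nogen L1 L2 u : L1 \in C -> L2 \in C -> L1 != L2 -> u != 0 ->
    u \in L1 -> u \in L2 -> u \notin L.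
  move=> L1C L2C L12 un0 u1 u2; apply/negP; rewrite memvE => uL.
  have := gen _ (is_point_line un0) uL.
  by rewrite leqNgt (multiplicity_two_lines L1C L2C) // -memvE.
have inC i : (i < size s)%N -> line_at s i \in C by move=> h; rewrite -sC mem_nth.
have neq i j : (i < size s)%N -> (j < size s)%N -> i != j -> line_at s i != line_at s j.
  by move=> hi hj ij; rewrite nth_uniq.
have out i j k : ((i == size s) || (j == size s) || (k == size s)) ->
    in_common_pencil i j k = false.
  move=> h; apply/negP => /in_common_pencil_lt[i7 j7 k7].
  by case/orP: h => [/orP[]|] /eqP e; move: s7; rewrite -e leqNgt ?i7 ?j7 ?k7.
move=> i j k; rewrite size_rcons !ltnS => hi hj hk ij ki kj.
rewrite !nth_rcons.
case: (ltngtP i (size s)) hi => // hi _; case: (ltngtP j (size s)) hj => // hj _;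
  case: (ltngtP k (size s)) hk => // hk _; rewrite ?sP //.
- rewrite out ?hk ?eqxx ?orbT //; apply/negbTE/concurrentP => -[u [un0 u1 u2 u3]].
  by case/negP: (nogen _ _ _ (inC i hi) (inC j hj) (neq _ _ hi hj ij) un0 u1 u2).
- rewrite out ?hj ?eqxx ?orbT //; apply/negbTE/concurrentP => -[u [un0 u1 u2 u3]].
  rewrite eq_sym in ki.
  by case/negP: (nogen _ _ _ (inC i hi) (inC k hk) (neq _ _ hi hk ki) un0 u1 u3).
- by rewrite hj hk eqxx in kj.
- rewrite out ?hi ?eqxx ?orbT //; apply/negbTE/concurrentP => -[u [un0 u1 u2 u3]].
  rewrite eq_sym in kj.
  by case/negP: (nogen _ _ _ (inC j hj) (inC k hk) (neq _ _ hj hk kj) un0 u2 u3).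
- by rewrite hi hk eqxx in ki.
- by rewrite hi hj eqxx in ij.
- by rewrite hi hj eqxx in ij.
Qed.

Lemma labelled_add_generic B C n s : add_generic_lines B n C -> labelled B s ->
  exists2 t, labelled C t & size t = (size s + n)%N.
Proof.
elim=> [|{}n {}C L _ IH lL LC gen] Bs; first by exists s; rewrite ?addn0.
have [t Ct ts] := IH Bs.
by exists (rcons t L); [apply: labelled_generic | rewrite size_rcons ts addnS].
Qed.

Lemma mem_fset_seven (T : choiceType) (a b c d e f g x : T) :
  (x \in [fset a; b; c; d; e; f; g]%fset) = (x \in [:: a; b; f; e; c; d; g]).
Proof.
rewrite !inE; case: (x == a); case: (x == b); case: (x == c); case: (x == d);
  by case: (x == e); case: (x == f); case: (x == g).
Qed.

(** The lines of [arrangement_B] in the order of [seven_lines], for the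
    points p1 = (0 : 0 : 1), p2 = (2 : 0 : 1), p3 = (-2 : 0 : 1), p4 = (-1 :
    1 : 1) and p5 = (1 : 1 : 1). *)
Definition lines_B : seq (int * int * int) :=
  [:: (0, 1, 0); (1, 1, 0); (1, 3%:R, - 2%:R); (-1, 1, - 2%:R);
      (-1, 1, 0); (1, 1, - 2%:R); (-1, 3%:R, - 2%:R)].

Lemma mem_arrangement_B : map (lineZ K) lines_B =i arrangement_B K.
Proof.
rewrite /lines_B /= !(mulr0z, mulr1z, mulrNz, mulrz_nat) => L.
by rewrite /arrangement_B mem_fset_seven.
Qed.

Lemma labelled_B : labelled (arrangement_B K) (map (lineZ K) lines_B).
Proof.
split=> [||//|].
- exact: uniq_lineZ.
- exact: mem_arrangement_B.
rewrite size_map => i j k hi hj hk ij ki kj.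
rewrite !(nth_map (0, 0, 0)) //.
have /allP/(_ i) : all (fun i => all (fun j => all (fun k =>
    [|| i == j, k == i, k == j |
     independent (nth (0, 0, 0) lines_B i) (nth (0, 0, 0) lines_B j) &&
     ((det3 (nth (0, 0, 0) lines_B i) (nth (0, 0, 0) lines_B j) (nth (0, 0, 0) lines_B k) == 0)
       == in_common_pencil i j k)]) (iota 0 7)) (iota 0 7)) (iota 0 7) by vm_compute.
rewrite mem_iota => /(_ hi)/allP/(_ j); rewrite mem_iota => /(_ hj)/allP/(_ k).
rewrite mem_iota => /(_ hk); rewrite (negPf ij) (negPf ki) (negPf kj) /= => /andP[ind /eqP <-].
exact: concurrent_lineZ.
Qed.

End FivePencils.


(** * Existence of generic lines *)

Section Generic.

Variable K : fieldType.
Hypothesis charK : [pchar K] =i pred0.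

Local Notation V := 'rV[K]_3.
Implicit Types (L M p q X Y : subspace K) (A B C P : {fset subspace K}) (s : seq (subspace K)).

(** Lines are the zero sets of nonzero row vectors x, and avoiding v is the
    nonvanishing at x of a linear form; over an infinite field finitely many
    such conditions can be met. *)
Lemma line_avoiding (s : seq V) : (forall v, v \in s -> v != 0) ->
  exists2 L : subspace K, is_line L & forall v, v \in s -> v \notin L.
Proof.
move=> sn0; pose e : V := vec 1 0 0.
have en0 : e != 0 by rewrite vec_eq0 oner_eq0.
have dotC (x v : V) : dot x v^T = dot v x^T.
  by rewrite !dotE; apply: eq_bigr => i _; rewrite !mxE mulrC.
(* The extra condition at e only ensures that x is nonzero when s is empty. *)
have [||x _] := @hform_prod_neq0 _ charK fullv _ (e :: s) (fun v x => dot x v^T).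
- by move=> v _; apply: hform_dot.
- move=> v vs; have vn0 : v != 0 by move: vs; rewrite inE => /predU1P[->|/sn0].
  have [/existsP[i vi]|] := boolP [exists i, v ord0 i != 0].
    exists (delta_mx ord0 i); rewrite ?memvf // dotE (bigD1 i) //= big1 => [|j ji].
      by rewrite !mxE !eqxx mul1r addr0.
    by rewrite !mxE (negPf ji) andbF mul0r.
  rewrite negb_exists => /forallP v0; case/eqP: vn0.
  by apply/rowP => i; rewrite mxE; apply/eqP; rewrite -[_ == _]negbK.
rewrite prodf_seq_neq0 => /allP xs.
have [a [b [c xE]]] := vecP x.
have lP (u : V) : (u \in line a b c) = (dot u x^T == 0).
  have [y [z [t ->]]] := vecP u.
  rewrite mem_line_vec dotE !big_ord_recl big_ord0 xE !mxE /= addr0 addrA.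
  by rewrite ![_ * a]mulrC ![_ * b]mulrC ![_ * c]mulrC.
exists (line a b c).
  apply: is_line_line; rewrite -xE.
  have := xs e (mem_head _ _); apply: contraTneq => ->.
  by rewrite /= /dot mul0mx mxE eqxx.
by move=> v vs; rewrite lP -dotC; apply: xs; rewrite inE vs orbT.
Qed.

(** Avoid the intersection points of the lines of C, and one point on each
    line of C so that the new line is not in C. *)
Lemma exists_generic_line C : is_arrangement C -> exists L, [/\ is_line L, L \notin C
  & forall p, is_point p -> (p <= L)%VS -> (multiplicity C p <= 1)%N].
Proof.
move=> arrC.
pose s := [seq vpick L | L <- enum_fset C] ++
  [seq vpick (LL.1 :&: LL.2)%VS |
     LL <- [seq (L1, L2) | L1 <- enum_fset C, L2 <- enum_fset C] & LL.1 != LL.2].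
have [|L lL Ls] := @line_avoiding s.
  move=> v; rewrite mem_cat => /orP[/mapP[M MC ->]|/mapP[[L1 L2]]].
    by rewrite vpick0 -dimv_eq0 (eqP (arrC M MC)).
  rewrite mem_filter => /andP[/= L12 /allpairsP[[M1 M2] /= [M1C M2C [L1E L2E]]]] ->.
  have /eqP d1 : is_point (L1 :&: L2)%VS by rewrite line_cap ?L1E ?L2E ?arrC // -L1E -L2E.
  by rewrite vpick0 -dimv_eq0 d1.
exists L; split=> //.
  apply/negP => LC; have := Ls (vpick L); rewrite memv_pick mem_cat map_f //.
  by move=> /(_ isT).
move=> p pp pL; rewrite leqNgt; apply/negP => p2.
have [[|L1 [|L2 r]] [us ss sE]] := fset_enum (erefl (multiplicity C p)).
- by rewrite -ss in p2.
- by rewrite -ss in p2.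
have mem M : M \in [:: L1, L2 & r] -> M \in C /\ (p <= M)%VS.
  by rewrite -sE !inE /= => /andP.
have [L1C pL1] := mem L1 (mem_head _ _).
have [|L2C pL2] := mem L2; first by rewrite !inE eqxx orbT.
have L12 : L1 != L2 by move: us; rewrite /= inE negb_or => /andP[/andP[]].
have := Ls (vpick (L1 :&: L2)%VS); rewrite mem_cat => /(_ _)/negP; apply.
  apply/orP; right; apply/mapP; exists (L1, L2) => //=.
  by rewrite mem_filter /= L12; apply/allpairsP; exists (L1, L2).
by rewrite -(point_on_two_lines pp (arrC _ L1C) (arrC _ L2C) L12 pL1 pL2) (subvP pL) ?memv_pick.
Qed.

Lemma exists_add_generic B n : is_arrangement B -> exists C, add_generic_lines B n C.
Proof.
move=> arrB; elim: n => [|n [C CB]]; first by exists B; constructor.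
have [L [lL LC gen]] := exists_generic_line (add_generic_arrangement CB arrB).
by exists (L |` C)%fset; apply: AddGenericLine.
Qed.

Lemma arrangement_B_lines : is_arrangement (arrangement_B K).
Proof.
move=> L; rewrite -mem_arrangement_B => /mapP[[[a b] c] abc ->].
apply: is_line_line; rewrite vec_eq0 !intr_eq0_char0 //.
by have /allP/(_ _ abc) : all (fun t => ~~ [&& t.1.1 == 0, t.1.2 == 0 & t.2 == 0]) lines_B by [].
Qed.

End Generic.

(** * Five triple points *)

Section FivePoints.

Variable K : fieldType.
Hypothesis charK : [pchar K] =i pred0.

Local Notation V := 'rV[K]_3.
Implicit Types (L M p q X Y : subspace K) (A B C P : {fset subspace K}) (s : seq (subspace K)).

Lemma lines_through_triple A p s : triple_point A p -> uniq s -> size s = 3%N ->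
    (forall L, L \in s -> L \in A /\ (p <= L)%VS) ->
  forall L, L \in A -> (p <= L)%VS = (L \in s).
Proof.
move=> p3 us s3 sA L LA.
have sub : ([fset L in s] `<=` [fset L in A | (p <= L)%VS])%fset.
  by apply/fsubsetP => M; rewrite !inE /= => /sA[-> ->].
have /fsetP/(_ L) : [fset L in s]%fset = [fset L in A | (p <= L)%VS]%fset.
  by apply/eqP; rewrite eqEfcard sub (triple_lines_card p3) card_fset_seq // s3.
by rewrite !inE /= LA => ->.
Qed.

Lemma concurrent_triple A P L1 L2 L3 : is_arrangement A -> max_triple A -> triple_points A P ->
    L1 \in A -> L2 \in A -> L3 \in A -> L1 != L2 -> L3 != L1 -> L3 != L2 ->
  concurrent L1 L2 L3 <-> exists2 p, p \in P & [/\ (p <= L1)%VS, (p <= L2)%VS & (p <= L3)%VS].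
Proof.
move=> arrA mA PA A1 A2 A3 L12 L31 L32; split.
  case/concurrentP => u [un0 u1 u2 u3]; rewrite !memvE in u1 u2 u3.
  exists <[u]>%VS => //; rewrite PA /triple_point /has_multiplicity is_point_line //=.
  rewrite eqn_leq mA ?is_point_line //=.
  have c3 : #|` [fset L in [:: L3; L1; L2]]%fset| = 3%N.
    by rewrite card_fset_seq //= !inE negb_or L31 L32 L12.
  rewrite -[leqLHS]c3; apply/fsubset_leq_card/fsubsetP => L; rewrite !inE /= ?orbF.
  by case/or3P => /eqP ->; rewrite ?A1 ?A2 ?A3.
case=> p pP [p1 p2 p3]; have [v vn0 pE] := is_pointP (triple_is_point PA pP).
by apply/concurrentP; exists v; rewrite !memvE -pE.
Qed.

(** A rich line M contains three triple points p1, p2, p3. The two other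
    ones, p4 and p5, must account for the two further lines through each of
    p1, p2, p3. This yields the seven lines; no line of A contains two of
    p1, p2, p3 except M, whence these lines are distinct. Any concurrence is
    a triple point, and its three lines are already among the seven. *)
Lemma five_points A P : is_arrangement A -> max_triple A -> triple_points A P ->
    extra A P -> #|` P| = 5%N ->
  [/\ exists s, labelled A s, log_field A (#|` A| - 4)
    & exists2 L, L \in A & #|` [fset q in P | (q <= L)%VS]%fset| = 2%N].
Proof.
move=> arrA mA PA ex P5.
have [|M MA M3] := exists_rich_line PA ex; first by rewrite P5.
have [t [ut ts tE]] := fset_enum (erefl #|` [fset p in P | (p <= M)%VS]%fset|).
case: t ut ts tE => [|p1 [|p2 [|p3 t]]] //= ut ts tE; try by rewrite -ts in M3.
have PM p : p \in [:: p1, p2, p3 & t] -> p \in P /\ (p <= M)%VS.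
  by rewrite -tE !inE /= => /andP.
have [[P1 M1] [P2 M2] [P3 M3']] : [/\ p1 \in P /\ (p1 <= M)%VS, p2 \in P /\ (p2 <= M)%VS
    & p3 \in P /\ (p3 <= M)%VS].
  by split; apply: PM; rewrite !inE eqxx ?orbT.
move: ut; rewrite !inE !negb_or -!andbA => /and3P[p12 p13 /and3P[_ p23 _]].
have sub3 : ([fset p in [:: p1; p2; p3]] `<=` P)%fset.
  by apply/fsubsetP => p; rewrite !inE /= ?orbF => /or3P[]/eqP->.
have c2 : #|` (P `\` [fset p in [:: p1; p2; p3]])%fset| = 2%N.
  by rewrite cardfsDS // P5 card_fset_seq //= !inE negb_or p12 p13 p23.
have [r [ur rs rE]] := fset_enum c2.
case: r ur rs rE => [|p4 [|p5 [|]]] //= ur _ rE.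
have p45 : p4 != p5 by move: ur; rewrite inE andbT.
have PE p : (p \in P) = (p \in [:: p1; p2; p3; p4; p5]).
  have := rE p; rewrite in_fsetD !inE /= ?orbF.
  have [->|n1] := eqVneq p p1; first by rewrite P1.
  have [->|n2] := eqVneq p p2; first by rewrite P2.
  have [->|n3] := eqVneq p p3; first by rewrite P3.
  by [].
have [P4 P5'] : p4 \in P /\ p5 \in P by rewrite !PE !inE !eqxx !orbT.
have pp p : p \in P -> is_point p by apply: triple_is_point PA.
have split3 q : q \in P -> [\/ (q <= M)%VS, q = p4 | q = p5].
  rewrite PE !inE => /orP[|/orP[|/or3P[]]] /eqP ->; by [constructor 1|constructor 2|constructor 3].
have joined p : p \in P -> (p <= M)%VS -> [/\ (p + p4)%VS \in A, (p + p5)%VS \in A,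
    (p + p4)%VS != (p + p5)%VS, (p + p4)%VS != M & (p + p5)%VS != M].
  by move=> pP pM; apply: (rich_line_joined arrA PA ex MA pP pM) => x xP _; apply: split3.
have [A14 A15 n1 M14 M15] := joined p1 P1 M1.
have [A24 A25 n2 M24 M25] := joined p2 P2 M2.
have [A34 A35 n3 M34 M35] := joined p3 P3 M3'.
have onM p q L : p \in P -> q \in P -> p != q -> (p <= M)%VS -> (q <= M)%VS -> L \in A ->
    (p <= L)%VS -> (q <= L)%VS -> L = M.
  by move=> pP qP pq pM qM LA pL qL; apply: (line_unique (pp p pP) (pp q qP) pq); rewrite ?arrA.
have ME : M = (p1 + p2)%VS by apply: line_through; rewrite ?pp ?arrA.
have neq p q x y : p \in P -> q \in P -> p != q -> (p <= M)%VS -> (q <= M)%VS ->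
    (p + x)%VS \in A -> (p + x)%VS != M -> (p + x)%VS != (q + y)%VS.
  move=> pP qP pq pM qM LA; apply: contraNneq => e.
  by apply/eqP/(onM p q) => //; rewrite ?addvSl // e addvSl.
set s7 := seven_lines p1 p2 p3 p4 p5.
have us7 : uniq s7.
  rewrite /= !inE !negb_or -ME ![M == _]eq_sym M14 M24 M34 M15 M25 M35 n1 n2 n3.
  by rewrite !neq // eq_sym.
have s7A L : L \in s7 -> L \in A.
  rewrite !inE => /orP[/eqP->|/orP[|/orP[|/orP[|/or3P[]]]] /eqP ->] //; by rewrite -ME.
have sA7 : ([fset L in s7] `<=` A)%fset by apply/fsubsetP => L; rewrite mem_fset_seq; apply: s7A.
have c7 : #|` [fset L in s7]%fset| = 7%N by rewrite card_fset_seq.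
have A7 : (7 <= #|` A|)%N by rewrite -c7 fsubset_leq_card.
set ps := [:: p1; p2; p3; p4; p5].
have ups : uniq ps.
  have : p4 \in (P `\` [fset p in [:: p1; p2; p3]])%fset by rewrite rE !inE eqxx.
  have : p5 \in (P `\` [fset p in [:: p1; p2; p3]])%fset by rewrite rE !inE eqxx orbT.
  rewrite !in_fsetD !inE /= !negb_or.
  move=> /andP[/and4P[n51 n52 n53 _] _] /andP[/and4P[n41 n42 n43 _] _].
  rewrite p12 p13 p23 p45 /= (eq_sym p1 p4) (eq_sym p2 p4) (eq_sym p3 p4).
  by rewrite (eq_sym p1 p5) (eq_sym p2 p5) (eq_sym p3 p5) n41 n42 n43 n51 n52 n53.
set t7 := s7 ++ [seq L <- enum_fset A | L \notin s7].
have tA : t7 =i A.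
  move=> L; rewrite mem_cat mem_filter; by have [/s7A ->|] := boolP (L \in s7).
have ut7 : uniq t7.
  rewrite cat_uniq us7 filter_uniq ?fset_uniq // andbT; apply/hasPn => L.
  by rewrite mem_filter => /andP[].
have t7E i : (i < 7)%N -> nth 0%VS t7 i = nth 0%VS s7 i.
  by move=> i7; rewrite nth_cat i7.
have incidence m i : (m < 5)%N -> i \in nth [::] five_pencils m ->
    [/\ (i < 7)%N & (nth 0 ps m <= nth 0 s7 i)%VS].
  case: m => [|[|[|[|[|//]]]]] _ /=; rewrite !inE => /or3P[] /eqP ->;
    by rewrite /= ?addvSl ?addvSr -?ME.
(* The incidences of the five points with all lines of A. *)
have row m i : (m < 5)%N -> (i < size t7)%N ->
    (nth 0 ps m <= nth 0 t7 i)%VS = (i \in nth [::] five_pencils m).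
  move=> m5 it; set r := nth [::] five_pencils m.
  have /andP[ur' r3] : uniq r && (size r == 3%N).
    have /allP/(_ r) : all (fun r => uniq r && (size r == 3%N)) five_pencils by [].
    by apply; apply: mem_nth.
  have pm : triple_point A (nth 0%VS ps m) by rewrite -PA PE mem_nth.
  rewrite (@lines_through_triple A _ [seq nth 0%VS t7 a | a <- r]) //.
  - apply/mapP/idP => [[a ar /eqP]|ir]; last by exists i.
    have [a7 _] := incidence m a m5 ar.
    by rewrite nth_uniq // => [/eqP -> //|]; rewrite size_cat ltn_addr.
  - rewrite map_inj_in_uniq // => a b ar br /eqP.
    have [[a7 _] [b7 _]] := (incidence m a m5 ar, incidence m b m5 br).
    by rewrite nth_uniq ?size_cat ?ltn_addr // => /eqP.
  - by rewrite size_map (eqP r3).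
  - move=> L /mapP[a ar ->]; have [a7 pa] := incidence m a m5 ar.
    by rewrite -tA t7E // pa mem_cat mem_nth.
  - by rewrite -tA mem_nth.
have mP p : p \in P -> exists2 m, (m < 5)%N & p = nth 0%VS ps m.
  by rewrite PE => /(nthP 0%VS)[m m5 <-]; exists m.
split.
- exists t7; split=> //.
  move=> i j k hi hj hk ij ki kj.
  have tin a : (a < size t7)%N -> nth 0%VS t7 a \in A by move=> ha; rewrite -tA mem_nth.
  have tneq a b : (a < size t7)%N -> (b < size t7)%N -> a != b -> nth 0%VS t7 a != nth 0%VS t7 b.
    by move=> ha hb ab; rewrite nth_uniq.
  have cP := concurrent_triple arrA mA PA (tin i hi) (tin j hj) (tin k hk)
    (tneq _ _ hi hj ij) (tneq _ _ hk hi ki) (tneq _ _ hk hj kj).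
  apply/idP/hasP => [/cP[p /mP[m m5 ->]]|[r r5]].
    rewrite !row // => -[ir jr kr]; exists (nth [::] five_pencils m).
      exact: mem_nth.
    by rewrite ir jr kr.
  rewrite -(nth_index [::] r5) => /and3P[ir jr kr].
  have m5 : (index r five_pencils < 5)%N by rewrite index_mem.
  apply/cP; exists (nth 0%VS ps (index r five_pencils)); first by rewrite PE mem_nth.
  by rewrite !row.
- have B3 : log_field [fset L in s7]%fset 3.
    apply: seven_log_field; rewrite ?pp // -?ME //.
      by apply: contraNN M14 => h; apply/eqP/esym/line_through; rewrite ?pp ?arrA //;
         move: ups; rewrite /ps /= !inE !negb_or => /and5P[/and4P[]].
    by apply: contraNN M15 => h; apply/eqP/esym/line_through; rewrite ?pp ?arrA //;
       move: ups; rewrite /ps /= !inE !negb_or => /and5P[/and4P[]].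
  have := log_field_extend charK sA7 arrA B3; rewrite cardfsDS // c7.
  have -> : (3 + (#|` A| - 7) = #|` A| - 4)%N by clear -A7; lia.
  exact.
- exists (p1 + p4)%VS => //.
  have c14 : #|` [fset q in [:: p1; p4]]%fset| = 2%N.
    rewrite card_fset_seq //= inE andbT.
    by move: ups; rewrite /ps /= !inE !negb_or => /and5P[/and4P[]].
  rewrite -[RHS]c14; congr #|` _|; apply/fsetP => q; rewrite !inE /= ?orbF.
  have it : (1 < size t7)%N by rewrite size_cat.
  apply/andP/orP => [[/mP[m m5 ->]]|].
    have := row m 1%N m5 it; rewrite t7E // [nth 0%VS s7 1%N]/= => ->.
    by case: m m5 => [|[|[|[|[|]]]]] //= _ _; [left | right].
  by case=> /eqP ->; rewrite ?P1 ?P4 ?addvSl ?addvSr.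
Qed.

End FivePoints.


(** * Minimal degrees *)

Section Assembly.

Variable K : fieldType.
Hypothesis charK : [pchar K] =i pred0.

Local Notation V := 'rV[K]_3.
Implicit Types (L M p q X Y : subspace K) (A B C P : {fset subspace K}) (s : seq (subspace K)).

Lemma card_set_of_lines A s : uniq s -> s =i A -> size s = #|` A|.
Proof. by move=> us sA; apply/perm_size/uniq_perm; rewrite ?fset_uniq. Qed.

Lemma extraE A P : triple_points A P -> lines_have_extra_triple_point A <-> extra A P.
Proof.
move=> PA; split=> ex p L.
  rewrite PA => pP LA pL; have [q [qP qp qL]] := ex p L pP LA pL.
  by exists q; rewrite PA.
rewrite -PA => pP LA pL; have [q [qP qp qL]] := ex p L pP LA pL.
by exists q; rewrite -PA.
Qed.

Lemma sole_or_extra A : (exists p L, sole_triple_point_on A p L) \/ lines_have_extra_triple_point A.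
Proof.
case: (classic (exists p L, sole_triple_point_on A p L)) => [|none]; [by left | right].
move=> p L p3 LA pL; apply: NNPP => noq; apply: none; exists p, L; split=> // q q3 qL.
by apply/eqP/negPn/negP => qp; apply: noq; exists q.
Qed.

Lemma sole_not_extra A p L : sole_triple_point_on A p L -> ~ lines_have_extra_triple_point A.
Proof.
by move=> [p3 LA pL sole] ex; have [q [q3 /eqP qp qL]] := ex p L p3 LA pL; apply/qp/sole.
Qed.

(** Removing a line with two triple points leaves at most three of them. *)
Lemma two_line_bound A P L r : is_arrangement A -> max_triple A -> triple_points A P ->
    (#|` P| <= 5)%N -> L \in A -> #|` [fset q in P | (q <= L)%VS]%fset| = 2%N ->
  log_field A r -> (#|` A| - 4 <= r)%N.
Proof.
move=> arrA mA PA P5 LA c2 Ar; have sA : (A `\ L `<=` A)%fset := fsubD1set _ _.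
have cA : #|` A| = #|` (A `\ L)%fset|.+1 by rewrite (cardfsD1 L) LA.
have cP := card_triples_split P L.
have sP r' : log_field (A `\ L)%fset r' -> (#|` (A `\ L)%fset| - 3 <= r')%N.
  apply: (degree_bound_few_triples charK (arrangement_sub sA arrA)
    (max_triple_sub sA mA) (triple_pointsD1 LA mA PA)).
  by rewrite c2 in cP; clear -cP P5; lia.
have := deletion_bound charK arrA mA PA LA sP Ar; rewrite c2.
by clear -cA; lia.
Qed.

(** The line L carries d - 2 points of intersection with the other lines. *)
Lemma sole_bound A P p L (s r : nat) : is_arrangement A -> max_triple A -> triple_points A P ->
    sole_triple_point_on A p L ->
    (forall r', log_field (A `\ L)%fset r' -> (s <= r')%N) -> log_field A r ->
  (minn s.+1 (#|` A| - 3) <= r)%N.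
Proof.
move=> arrA mA PA [p3 LA pL sole] sP Ar.
have := deletion_bound charK arrA mA PA LA sP Ar.
rewrite (@card_sole _ P p) ?PA -?subnDA // => q; rewrite PA; exact: sole.
Qed.

Lemma card_sole_deletion A P p L : max_triple A -> triple_points A P ->
    sole_triple_point_on A p L ->
  exists P', triple_points (A `\ L)%fset P' /\ #|` P| = #|` P'|.+1.
Proof.
move=> mA PA [p3 LA pL sole]; exists [fset p in P | ~~ (p <= L)%VS]%fset.
split; first exact: triple_pointsD1.
rewrite (card_triples_split P L) (@card_sole _ P p) ?PA // => q; rewrite PA; exact: sole.
Qed.

Lemma four_not_extra_bound A P r : is_arrangement A -> max_triple A -> triple_points A P ->
    #|` P| = 4%N -> ~ lines_have_extra_triple_point A -> log_field A r ->
  (#|` A| - 3 <= r)%N.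
Proof.
move=> arrA mA PA P4 nex Ar; have [[p [L sole]]|//] := sole_or_extra A.
have [P' [PA' PP']] := card_sole_deletion mA PA sole.
have LA : L \in A by case: sole.
have sA : (A `\ L `<=` A)%fset := fsubD1set _ _.
have cA : #|` A| = #|` (A `\ L)%fset|.+1 by rewrite (cardfsD1 L) LA.
have sP r' : log_field (A `\ L)%fset r' -> (#|` (A `\ L)%fset| - 3 <= r')%N.
  apply: (degree_bound_few_triples charK (arrangement_sub sA arrA) (max_triple_sub sA mA) PA').
  by rewrite -ltnS -PP' P4.
have := sole_bound arrA mA PA sole sP Ar.
by clear -cA; lia.
Qed.

Lemma four_bound A P r : is_arrangement A -> max_triple A -> triple_points A P ->
  #|` P| = 4%N -> log_field A r -> (#|` A| - 4 <= r)%N.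
Proof.
move=> arrA mA PA P4 Ar; have [[q [M soleM]]|/(extraE PA) ex] := sole_or_extra A.
  apply: leq_trans (four_not_extra_bound arrA mA PA P4 (sole_not_extra soleM) Ar).
  exact: leq_sub2l.
have [_ _ [M MA c2]] := four_points charK arrA mA PA ex P4.
by apply: (two_line_bound arrA mA PA _ MA c2 Ar); rewrite P4.
Qed.

Lemma log_field_triple A p : is_arrangement A -> triple_point A p -> log_field A (#|` A| - 3).
Proof.
move=> arrA /andP[pp /eqP m3]; rewrite -[X in (_ - X)%N]m3.
exact: log_field_multiplicity.
Qed.

End Assembly.

Theorem theorem4p18 (K : fieldType) (charK : [pchar K] =i pred0)
    (A : {fset subspace K}) (f : {mpoly K[3]}) (d n2 n3 : nat)
    (A_arr : is_arrangement A) (A_f : is_equation A f)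
    (A_d : #|` A|%fset = d) (d_ge2 : (2 <= d)%N)
    (A_n2 : nb_points 2 A n2) (A_n3 : nb_points 3 A n3)
    (A_mult : forall p, is_point p -> (multiplicity A p <= 3)%N) :
  [/\ n3 = 0%N -> min_syzygy_degree f (d - 2),
      (1 <= n3 <= 3)%N -> min_syzygy_degree f (d - 3),
      n3 = 4%N ->
        (~ lines_have_extra_triple_point A -> min_syzygy_degree f (d - 3)) /\
        (lines_have_extra_triple_point A ->
           from_A223 A (d - 6) /\ min_syzygy_degree f (d - 4))
    & n3 = 5%N ->
        [/\ (exists p L, sole_triple_point_on A p L) \/
              lines_have_extra_triple_point A,
            forall p L, sole_triple_point_on A p L ->
              (from_A223 (A `\ L)%fset (d - 7) ->
                 min_syzygy_degree f (d - 4)) /\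
              (~ from_A223 (A `\ L)%fset (d - 7) ->
                 min_syzygy_degree f (d - 3))
          & lines_have_extra_triple_point A ->
              [/\ min_syzygy_degree f (d - 4),
                  exists C, add_generic_lines (arrangement_B K) (d - 7) C
                & forall C, add_generic_lines (arrangement_B K) (d - 7) C ->
                    same_intersection_lattice A C]]].
Proof.
have An0 : A != fset0 by rewrite -cardfs_gt0 A_d; apply: ltnW.
have min r := @min_syzygy_degreeP K charK A f A_arr A_f r An0.
case: A_n3 => P P_n3 PA; rewrite -P_n3.
have triple_upper : (0 < #|` P|)%N -> log_field A (d - 3).
  rewrite cardfs_gt0 => /fset0Pn[p]; rewrite PA -A_d.
  exact: log_field_triple.
have sA L : (A `\ L `<=` A)%fset := fsubD1set _ _.
split.
- move=> P0; apply: min.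
    have [[|L1 [|L2 s]] [us ss sE]] := fset_enum A_d; try by rewrite -ss in d_ge2.
    have [A1 A2] : L1 \in A /\ L2 \in A by rewrite !sE !inE !eqxx orbT.
    have L12 : L1 != L2 by move: us; rewrite /= inE negb_or => /andP[/andP[]].
    (* Without triple points, two lines meet in a double point. *)
    have pp := line_cap (A_arr _ A1) (A_arr _ A2) L12.
    have m2 := multiplicity_two_lines A1 A2 L12 (capvSl _ _) (capvSr _ _).
    suff m2' : multiplicity A (L1 :&: L2)%VS = 2%N.
      by rewrite -A_d -[X in (_ - X)%N]m2'; apply: log_field_multiplicity.
    apply/eqP; rewrite eqn_leq m2 andbT -ltnS ltn_neqAle A_mult // andbT.
    have := PA (L1 :&: L2)%VS; rewrite (cardfs0_eq P0) inE /triple_point /has_multiplicity pp /=.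
    by move=> <-.
  move=> r; rewrite -A_d; apply: degree_bound_no_triple => //.
  by rewrite -(cardfs0_eq P0).
- move=> /andP[P1 P3]; apply: min; first exact: triple_upper.
  by move=> r; rewrite -A_d; apply: degree_bound_few_triples PA P3.
- move=> P4; split=> [nex|/(extraE PA) ex].
    apply: min => [|r]; first by apply: triple_upper; rewrite P4.
    by rewrite -A_d; apply: four_not_extra_bound PA P4 nex.
  have [fromA upper [L LA c2]] := four_points charK A_arr A_mult PA ex P4.
  rewrite -A_d; split=> //; apply: min => // r.
  by apply: (two_line_bound charK A_arr A_mult PA _ LA c2); rewrite P4.
move=> P5; split; first exact: sole_or_extra.
- move=> p L sole; have [P' [PA' PP']] := card_sole_deletion A_mult PA sole.
  have {PP'} P4 : #|` P'| = 4%N by rewrite P5 in PP'; clear -PP'; lia.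
  have LA : L \in A by case: sole.
  have cA : #|` A| = #|` (A `\ L)%fset|.+1 by rewrite (cardfsD1 L) LA.
  have arrL := arrangement_sub (sA L) A_arr.
  have mL := max_triple_sub (sA L) A_mult.
  split=> [fromL|nfrom]; last first.
    apply: min => [|r Ar]; first by apply: triple_upper; rewrite P5.
    have nex : ~ lines_have_extra_triple_point (A `\ L)%fset.
      move=> /(extraE PA') ex; apply: nfrom.
      have [fromL _ _] := four_points charK arrL mL PA' ex P4.
      suff -> : (d - 7 = #|` (A `\ L)%fset| - 6)%N by [].
      by rewrite -A_d; clear -cA; lia.
    (* Here the smaller arrangement has degree d - 4, and adding L increases
       it. *)
    have sP r' := four_not_extra_bound (r := r') charK arrL mL PA' P4 nex.
    have := sole_bound charK A_arr A_mult PA sole sP Ar; rewrite -A_d.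
    by clear -cA; lia.
  (* The degree of the smaller arrangement goes up by exactly one: multiply
     by the equation of L for the upper bound, and use the d - 2 points on L
     for the lower bound. *)
  have [L2 cL] := from_A223_log_field charK arrL fromL.
  have dE : (d = 7 + (d - 7))%N by rewrite -{1}A_d cA cL.
  apply: min => [|r Ar].
    have := log_field_addition charK (A_arr L LA) L2; rewrite fsetD1K //.
    have -> : ((2 + (d - 7)).+1 = d - 4)%N by clear -dE; lia.
    exact.
  have sP r' := four_bound (r := r') charK arrL mL PA' P4.
  have := sole_bound charK A_arr A_mult PA sole sP Ar.
  by clear -cA cL dE A_d; lia.
- move=> /(extraE PA) ex.
  have [[s As] upper [L LA c2]] := five_points charK A_arr A_mult PA ex P5.
  have [us sE s7 _] := As.
  have cs : size s = d by rewrite -A_d; apply: card_set_of_lines.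
  split.
  + rewrite -A_d; apply: min => // r.
    by apply: (two_line_bound charK A_arr A_mult PA _ LA c2); rewrite P5.
  + by apply: exists_add_generic => //; apply: arrangement_B_lines.
  move=> C BC; have [t Ct ct] := labelled_add_generic BC (labelled_B charK).
  apply: labelled_lattice As Ct _ => //.
    exact: add_generic_arrangement BC (arrangement_B_lines charK).
  by rewrite ct cs /= subnKC // -cs.
Qed.
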